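(* For every graph $F$ with at least one edge, there are infinitely many real numbers $r$ such that there exists some graph $H$ with $\mathrm{ex}(n,F,H)=\Theta(n^r)$.
   Context: All graphs are finite and simple. For graphs $F$ and $H$ and a positive integer $n$, a graph is $H$-free if it does not contain $H$ as a (not necessarily induced) subgraph, and $\mathrm{ex}(n,F,H)$ denotes the maximum number of copies of $F$ (i.e. subgraphs, not necessarily induced, isomorphic to $F$) in an $H$-free graph on $n$ vertices. The asymptotic notation $\Theta(n^r)$ is as $n\to\infty$ with $F$, $H$, $r$ fixed. *)

(* Defs.v *)
From HB Require Import structures.
From mathcomp Require Import all_boot.

Set Implicit Arguments.
Unset Strict Implicit.
Unset Printing Implicit Defensive.

(* A simple graph on the vertex set V is its set of edges, each edge being a
   two-element set of vertices. *)
Record sgraph (V : finType) := SGraph {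
  edges :> {set {set V}};
  _ : [forall e in edges, #|e| == 2] }.

HB.instance Definition _ (V : finType) := [isSub for @edges V].
HB.instance Definition _ (V : finType) := [Finite of sgraph V by <:].

(* The vertex set of a subgraph is recorded separately from its edge set,
   because a subgraph may have isolated vertices. *)
Definition is_subgraph (V : finType) (G : sgraph V)
    (S : {set V} * {set {set V}}) : bool :=
  (S.2 \subset edges G) && [forall e in S.2, e \subset S.1].

Definition isomorphic_to (V T : finType) (F : sgraph V)
    (S : {set T} * {set {set T}}) : bool :=
  [exists f : {ffun V -> T},
    [&& injectiveb f, f @: [set: V] == S.1
      & [set f @: e | e : {set V} in edges F] == S.2]].

Definition copies (V T : finType) (F : sgraph V) (G : sgraph T) :
    {set {set T} * {set {set T}}} :=
  [set S | is_subgraph G S && isomorphic_to F S].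

Definition free_of (W T : finType) (H : sgraph W) (G : sgraph T) : bool :=
  copies H G == set0.

(* ex(n, F, H). The value is 0 when no graph on n vertices is H-free, which
   for n >= #|W| happens exactly when H has no edge. *)
Definition exnum (n : nat) (V W : finType) (F : sgraph V) (H : sgraph W) : nat :=
  \max_(G : sgraph 'I_n | free_of H G) #|copies F G|.

(* Main.v *)
Require Import Defs.
From mathcomp Require Import all_boot all_order all_algebra finfield cyclic.
From mathcomp Require Import zify ring lra.
From mathcomp Require Import reals exp.

(** Write v and e for the numbers of vertices and edges of F, with e >= 1. For
    every s >= v, e and every t large enough in terms of s and v,
    ex(n, F, K_(s,t)) has order n^(v - e/s): the order expected in a random
    graph of density n^(-1/s), which is the largest density of a K_(s,t)-free
    graph up to a constant. As e >= 1, distinct values of s give distinct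
    exponents.

    Lower bound. Let K be the field with q^s elements, and let N be its norm to
    the subfield with q elements. Take one copy of K for each vertex of F and,
    for an edge uw of F, join x in copy u to y in copy w when
    N(x + y + c_uw) = b_uw, where c_uw and b_uw depend on the edge only. A
    value b_uw is taken by N about q^(s-1) times, so that for a random choice
    of the shifts c a map sending each u to copy u is an embedding of F with
    probability about q^(-e), the conditions at different edges being
    independent ([exists_good_shift]). No s vertices have many common
    neighbours: these solve s equations N(y + a_i) = b_i in y. If two of the
    a_i agree, they come from two different edges, and the values b being
    distinct there is no solution. If the a_i are distinct, then N(y + a_i) is
    the product over j < s of y^(q^j) + a_i^(q^j), and the number of solutions
    is at most a constant depending on s only ([product_system_bound]): the
    functions on the solution set are spanned by boundedly many monomials in
    the conjugates. A power of 2 can be chosen for q such that q^s is within a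
    constant factor of n / v.

    Upper bound. Embed the vertices of F one at a time into a K_(s,t)-free
    graph G, maintaining for each vertex i not yet embedded the set D_i of
    candidates, that is, the common neighbours of the images of the embedded
    neighbours of i ([embeddings_bound]). Once p neighbours of i are embedded,
    any s - p further vertices have a bounded number of common neighbours in
    D_i, which bounds the sum, over the images x of i, of the (s - p)-th powers
    of the degrees of x into each other candidate set. An inequality of Hoelder
    type then bounds the number of completions by a product of powers of the
    sizes |D_i|, whose exponents sum to v - e/s at the start, when all D_i are
    the full vertex set. Images of small degree into some candidate set escape
    the inequality, but they contribute only O(n^(v-1)), and
    v - 1 <= v - e/s. *)

Set Implicit Arguments.
Unset Strict Implicit.
Unset Printing Implicit Defensive.
Import Order.TTheory GRing.Theory Num.Theory.

(** * Systems of s products of s linear forms *)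

Section ProductSystems.
Local Open Scope ring_scope.

Section MonomialSpan.
Variables (K : fieldType) (I : finType).
Implicit Types (f g h : {ffun I -> K} -> K) (S : {pred {ffun I -> K}}).
Implicit Types (B : (I -> nat) -> Prop) (al be : I -> nat).

Definition monomial al (x : {ffun I -> K}) : K := \prod_j x j ^+ al j.

Lemma monomial0 x : monomial (fun=> 0%N) x = 1.
Proof. by rewrite /monomial big1. Qed.

Lemma monomialD al be x : monomial (fun j => al j + be j)%N x = monomial al x * monomial be x.
Proof. by rewrite /monomial -big_split; apply: eq_bigr => j _; rewrite exprD. Qed.

Lemma monomial_delta k x : monomial (fun j => (j == k) : nat) x = x k.
Proof.
rewrite /monomial (bigD1 k) //= eqxx big1 ?mulr1 // => j /negPf ->.
by rewrite expr0.
Qed.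

Lemma eq_monomial al be : al =1 be -> monomial al =1 monomial be.
Proof. by move=> e x; apply: eq_bigr => j _; rewrite e. Qed.

(** [spanned S B f]: on S, the function f agrees with a linear combination of
    monomials with exponents in B. Agreement is required on S only because
    the equations of a system are used as rewriting rules on its solution set.
    A combination is built term by term since the exponent vectors range over
    an infinite type. *)
Inductive spanned S B : ({ffun I -> K} -> K) -> Prop :=
| Spanned0 f of (forall x, x \in S -> f x = 0) : spanned S B f
| SpannedD c al f g of B al & spanned S B f
    & (forall x, x \in S -> g x = c * monomial al x + f x) : spanned S B g.

Lemma eq_spanned S B f g :
  (forall x, x \in S -> g x = f x) -> spanned S B f -> spanned S B g.
Proof.
move=> e sf; elim: sf g e => {f} [f f0|c al f h Bal sf IH eh] g e.
  by apply: Spanned0 => x Sx; rewrite e ?f0.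
by apply: (SpannedD (c := c) Bal sf) => x Sx; rewrite e ?eh.
Qed.

Lemma spannedS S S' B B' f : ({subset S' <= S}) ->
  (forall al, B al -> B' al) -> spanned S B f -> spanned S' B' f.
Proof.
move=> SS BB; elim=> {f} [f f0|c al f g Bal _ sf eg].
  by apply: Spanned0 => x /SS; apply: f0.
by apply: (SpannedD (c := c) (BB _ Bal) sf) => x /SS; apply: eg.
Qed.

Lemma spanned_monomial S B c al : B al -> spanned S B (fun x => c * monomial al x).
Proof.
move=> Bal; apply: (SpannedD (c := c) Bal (@Spanned0 S B (fun=> 0) _)) => // x _.
by rewrite addr0.
Qed.

Lemma spanned_add S B f g :
  spanned S B f -> spanned S B g -> spanned S B (fun x => f x + g x).
Proof.
move=> sf sg; elim: sf => {f} [f f0|c al f h Bal _ sf eh].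
  by apply: eq_spanned sg => x Sx; rewrite f0 ?add0r.
by apply: (SpannedD (c := c) Bal sf) => x Sx; rewrite eh // addrA.
Qed.

Lemma spanned_mul S B1 B2 B f g :
    (forall al be, B1 al -> B2 be -> B (fun j => al j + be j)%N) ->
  spanned S B1 f -> spanned S B2 g -> spanned S B (fun x => f x * g x).
Proof.
move=> BB sf sg; elim: sf => {f} [f f0|c al f h Bal _ sf eh].
  by apply: Spanned0 => x Sx; rewrite f0 ?mul0r.
suff sm: spanned S B (fun x => c * monomial al x * g x).
  by apply: eq_spanned (spanned_add sm sf) => x Sx; rewrite eh // mulrDl.
elim: sg => {f sf h eh g} [g g0|d be f g Bbe _ sf eg].
  by apply: Spanned0 => x Sx; rewrite g0 ?mulr0.
apply: (SpannedD (c := c * d) (BB _ _ Bal Bbe) sf) => x Sx.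
by rewrite eg // mulrDr monomialD mulrACA.
Qed.

Lemma spanned_sum S B (J : Type) (r : seq J) (P : pred J) F :
  (forall i, P i -> spanned S B (F i)) ->
  spanned S B (fun x => \sum_(i <- r | P i) F i x).
Proof.
move=> sF; elim: r => [|i r IH]; first by apply: Spanned0 => x _; rewrite big_nil.
case Pi: (P i); last by apply: eq_spanned IH => x _; rewrite big_cons Pi.
by apply: eq_spanned (spanned_add (sF i Pi) IH) => x _; rewrite big_cons Pi.
Qed.

Lemma spanned_scale S B c f : spanned S B f -> spanned S B (fun x => c * f x).
Proof.
elim=> {f} [f f0|d al f g Bal _ sf eg].
  by apply: Spanned0 => x Sx; rewrite f0 ?mulr0.
by apply: (SpannedD (c := c * d) Bal sf) => x Sx; rewrite eg // mulrDr mulrA.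
Qed.

Lemma spanned_trans S B B' f :
  (forall al, B al -> spanned S B' (monomial al)) ->
  spanned S B f -> spanned S B' f.
Proof.
move=> BB; elim=> {f} [f f0|c al f g Bal _ sf eg]; first exact: Spanned0.
by apply: eq_spanned eg (spanned_add (spanned_scale c (BB _ Bal)) sf).
Qed.

Definition box (d : I -> nat) al := forall j, (al j <= d j)%N.

Lemma spanned_const S c : spanned S (box (fun=> 0%N)) (fun=> c).
Proof.
apply: eq_spanned (spanned_monomial S c (al := fun=> 0%N) _) => // x _.
by rewrite monomial0 mulr1.
Qed.

Lemma spanned_prod S (J : eqType) (r : seq J) (P : pred J) (d : J -> I -> nat) F :
    (forall i, i \in r -> P i -> spanned S (box (d i)) (F i)) ->
  spanned S (box (fun j => \sum_(i <- r | P i) d i j)%N)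
            (fun x => \prod_(i <- r | P i) F i x).
Proof.
elim: r => [|i r IH] sF.
  apply: eq_spanned (spannedS _ _ (spanned_const S 1)) => //= [x _|al bal j].
    by rewrite big_nil.
  by rewrite big_nil; apply: bal.
have {}IH := IH (fun k kr => sF k (mem_behead (s := i :: r) kr)).
case Pi: (P i); last first.
  apply: eq_spanned (spannedS _ _ IH) => //= [x _|al bal j].
    by rewrite big_cons Pi.
  by rewrite big_cons Pi; apply: bal.
apply: eq_spanned (spanned_mul _ (sF i (mem_head i r) Pi) IH) => [x _|al be Ba Bb j].
  by rewrite big_cons Pi.
by rewrite big_cons Pi; apply: leq_add.
Qed.

Lemma spanned_linear S k a :
  spanned S (box (fun j => (j == k) : nat)) (fun x => x k - a).
Proof.
have s1 : spanned S (box (fun j => (j == k) : nat)) (fun x => x k).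
  apply: eq_spanned (spanned_monomial S 1 (al := fun j => (j == k) : nat) _).
    by move=> x _; rewrite mul1r monomial_delta.
  by move=> j.
apply: (spanned_add s1); apply: spannedS (spanned_const S (- a)) => // al bal j.
by rewrite (leq_trans (bal j)).
Qed.

(** If the indicator of each point of s is a combination of the
    (d + 1)^|I| monomials with exponents at most d, then the identity matrix
    of size |s| factors through the space of coefficients of these
    monomials. *)
Lemma card_spanned (d : nat) (s : seq {ffun I -> K}) : uniq s ->
    (forall p, p \in s -> spanned (mem s) (box (fun=> d)) (fun x => (x == p)%:R)) ->
  (size s <= d.+1 ^ #|I|)%N.
Proof.
move=> us sp.
pose A := {ffun I -> 'I_d.+1}.
have coef f : spanned (mem s) (box (fun=> d)) f ->
    exists c : A -> K, forall q, q \in s ->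
      f q = \sum_(a : A) c a * monomial (fun j => a j : nat) q.
  elim=> {f} [f f0|c al f g Bal _ [cf ef] eg].
    by exists (fun=> 0) => q /f0 ->; rewrite big1 // => a _; rewrite mul0r.
  pose a0 : A := [ffun j => inord (al j)].
  exists (fun a => (if a == a0 then c else 0) + cf a) => q qs.
  rewrite eg // ef //; under [RHS]eq_bigr do rewrite mulrDl.
  rewrite big_split /=; congr (_ + _); rewrite (bigD1 a0) //= big1 => [|a /negPf ->].
    rewrite eqxx addr0; congr (_ * _); apply: eq_monomial => j.
    by rewrite ffunE inordK // ltnS.
  by rewrite mul0r.
have cP (i : 'I_(size s)) : exists c : A -> K, forall q, q \in s ->
    (q == tnth (in_tuple s) i)%:R = \sum_(a : A) c a * monomial (fun j => a j : nat) q.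
  exact: coef _ (sp _ (mem_tnth i (in_tuple s))).
have [C CE] := fin_all_exists cP.
pose B := \matrix_(i < size s, a < #|A|) C i (enum_val a).
pose M := \matrix_(a < #|A|, i < size s)
  monomial (fun j => (enum_val a : A) j : nat) (tnth (in_tuple s) i).
have BM : B *m M = 1%:M.
  apply/matrixP => i k; rewrite !mxE.
  transitivity ((tnth (in_tuple s) k == tnth (in_tuple s) i)%:R : K); last first.
    by rewrite (inj_eq (tuple_uniqP _ _)) // eq_sym.
  rewrite CE ?mem_tnth // [RHS](reindex (@enum_val A predT)) /=; last first.
    by exists enum_rank => a _; rewrite ?enum_valK ?enum_rankK.
  by apply: eq_bigr => a _; rewrite !mxE.
have := mulmx_max_rank B M; rewrite BM mxrank1 card_ffun card_ord.
exact.
Qed.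

End MonomialSpan.

(** The difference of the two sides is a polynomial in x of degree less than
    |E| that vanishes at the |E| points v i. *)
Lemma lagrange_sum1 (K : fieldType) (I : finType) (v : I -> K) (E : {set I}) x :
    injective v -> E != set0 ->
  \sum_(i in E) (\prod_(j in E :\ i) (v i - v j))^-1 * \prod_(j in E :\ i) (x - v j)
    = 1.
Proof.
move=> injv E0.
pose p : {poly K} := \sum_(i in E) (\prod_(j in E :\ i) (v i - v j))^-1 *:
                      \prod_(j in E :\ i) ('X - (v j)%:P) - 1.
have pE y : p.[y] = \sum_(i in E) (\prod_(j in E :\ i) (v i - v j))^-1 *
                                   \prod_(j in E :\ i) (y - v j) - 1.
  rewrite hornerD hornerN hornerC horner_sum; congr (_ - _).
  apply: eq_bigr => i _; rewrite hornerZ horner_prod; congr (_ * _).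
  by apply: eq_bigr => j _; rewrite !hornerE.
have [p0|pn0] := eqVneq p 0.
  by apply/eqP; rewrite -subr_eq0 -pE p0 horner0.
have szp : (size p <= #|E|)%N.
  apply: leq_trans (size_polyD _ _) _; rewrite geq_max size_polyN size_poly1.
  rewrite card_gt0 E0 andbT; apply: leq_trans (size_sum _ _ _) _.
  apply/bigmax_leqP => i iE; apply: leq_trans (size_scale_leq _ _) _.
  by rewrite -big_enum /= size_prod_XsubC -cardE (cardsD1 i E) iE.
have rp : all (root p) [seq v i | i <- enum E].
  apply/allP => _ /mapP[i + ->]; rewrite mem_enum => iE.
  rewrite rootE pE (bigD1 i) //= mulVf; last first.
    apply/prodf_neq0 => j; rewrite !inE => /andP[ji _].
    by rewrite subr_eq0 (inj_eq injv) eq_sym.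
  rewrite big1 ?addr0 ?subrr // => j /andP[jE ji].
  by rewrite [X in _ * X](big_setD1 i) ?inE 1?eq_sym ?ji //= subrr mul0r mulr0.
have := max_poly_roots pn0 rp.
rewrite map_inj_uniq // enum_uniq size_map -cardE => /(_ isT) /leq_trans /(_ szp).
by rewrite ltnn.
Qed.

Section ProductSystem.
Variables (K : fieldType) (I : finType) (a : I -> I -> K).
Hypothesis inj_a : forall k, injective (a^~ k).

(** As the values a i k are distinct for fixed k, a coordinate x k annihilates
    at most one of the products, so that more products than coordinates have no
    common zero. The induction on the number of coordinates makes the resulting
    Bezout identity explicit, with degrees bounded in terms of |I| alone:
    removing a coordinate k and an equation i0 gives cofactors [g i0] expressing
    the product of the x k - a i k over i <> i0, and the Lagrange identity
    combines these products into 1. *)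
Lemma products_bezout (Q E : {set I}) : (#|Q| < #|E|)%N ->
  exists g : I -> {ffun I -> K} -> K,
    (forall i, spanned predT (box (fun k => if k \in Q then #|I| else 0%N)) (g i)) /\
    forall x : {ffun I -> K}, \sum_(i in E) g i x * \prod_(k in Q) (x k - a i k) = 1.
Proof.
move: {2}#|Q| (erefl #|Q|) => n; elim: n Q E => [|n IH] Q E cQ QE.
  move/eqP: cQ; rewrite cards_eq0 => /eqP Q0.
  have [i0 i0E] : exists i, i \in E by apply/card_gt0P; apply: leq_trans QE.
  exists (fun i _ => (i == i0)%:R); split=> [i|x].
    by apply: spannedS (spanned_const _ _) => // al bal j; rewrite (leq_trans (bal j)).
  rewrite (bigD1 i0) //= eqxx Q0 big_set0 mul1r big1 ?addr0 // => i /andP[_ /negPf->].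
  by rewrite mul0r.
have [k kQ] : exists k, k \in Q by apply/card_gt0P; rewrite cQ.
pose Q' := Q :\ k.
have cQ' : #|Q'| = n by move: cQ; rewrite (cardsD1 k) kQ => -[].
have {}IH (i0 : I) : exists g : I -> {ffun I -> K} -> K, i0 \in E ->
    (forall i, spanned predT (box (fun k => if k \in Q' then #|I| else 0%N)) (g i)) /\
    forall x : {ffun I -> K}, \sum_(i in E :\ i0) g i x * \prod_(k in Q') (x k - a i k) = 1.
  case i0E: (i0 \in E); last by exists (fun _ _ => 0).
  have [|g gP] := IH Q' (E :\ i0) cQ'; last by exists g.
  by move: QE; rewrite cQ' cQ (cardsD1 i0) i0E.
have {IH} [g gP] := fin_all_exists IH.
pose w i0 := (\prod_(i in E :\ i0) (a i0 k - a i k))^-1.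
(* The cofactor of the equation i collects its cofactors in the identities for
   E :\ i0, weighted by the Lagrange coefficients w i0. *)
exists (fun i x => \sum_(i0 in E | i0 != i)
   w i0 * (g i0 i x * \prod_(i' in E | (i' != i0) && (i' != i)) (x k - a i' k))).
split=> [i|x].
  apply: spanned_sum => i0 /andP[i0E i0i]; apply: spanned_scale.
  have sp := spanned_prod (r := index_enum I)
    (P := fun i' => (i' \in E) && ((i' != i0) && (i' != i)))
    (fun i' _ _ => spanned_linear predT k (a i' k)).
  apply: spanned_mul ((gP _ i0E).1 i) sp => al be Bal Bbe j.
  have := Bal j; have := Bbe j.
  rewrite sum_nat_const !inE; have [->|jk] := eqVneq j k => /=.
    by rewrite kQ muln1 leqn0 => le1 /eqP ->; rewrite (leq_trans le1) ?max_card.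
  by rewrite muln0 leqn0 => /eqP ->; rewrite addn0.
rewrite -[RHS](lagrange_sum1 (x k) (inj_a (k := k)) (E := E)); last first.
  by rewrite -card_gt0; apply: leq_trans QE.
under eq_bigr do rewrite mulr_suml.
rewrite (exchange_big_dep (fun i => i \in E)) /=; last by move=> i j _ /andP[].
apply: eq_bigr => i0 i0E; rewrite -/(w i0).
transitivity (w i0 * \prod_(j in E :\ i0) (x k - a j k) *
  \sum_(i in E :\ i0) g i0 i x * \prod_(k in Q') (x k - a i k)); last first.
  by rewrite (gP _ i0E).2 mulr1.
rewrite mulr_sumr.
apply: eq_big => [i|i /andP[iE /andP[_ ii0]]].
  by rewrite !inE i0E andbC eq_sym.
have -> : \prod_(k' in Q) (x k' - a i k') =
    (x k - a i k) * \prod_(k' in Q') (x k' - a i k').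
  by rewrite (bigD1 k) //=; congr (_ * _); apply: eq_bigl => j; rewrite !inE andbC.
have -> : \prod_(j in E :\ i0) (x k - a j k) = (x k - a i k) *
    \prod_(i' in E | (i' != i0) && (i' != i)) (x k - a i' k).
  rewrite (bigD1 i) ?inE 1?eq_sym ?ii0 //=; congr (_ * _); apply: eq_bigl => j.
  by rewrite !inE; do 2!case: (_ != _); rewrite ?andbT ?andbF.
set p1 := \prod_(_ in E | _) _; set p2 := \prod_(_ in Q') _.
by ring.
Qed.

(** The exponents of the monomials that may replace the product of the x j over
    j in J: strictly smaller on J, while those outside J may grow up to c. *)
Definition below (J : {set I}) (c : nat) (al : I -> nat) :=
  [/\ forall j, j \in J -> (al j <= 1)%N, exists2 j, j \in J & al j = 0%N
    & forall k, k \notin J -> (al k <= c)%N].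

Lemma prod_shift_below (v : I -> K) (J : {set I}) :
  spanned predT (below J 0)
    (fun x => \prod_(j in J) x j - \prod_(j in J) (x j - v j)).
Proof.
suff H r : uniq r -> spanned predT
    (fun al => [/\ forall j, (al j <= (j \in r))%N & exists2 j, j \in r & al j = 0%N])
    (fun x => \prod_(j <- r) x j - \prod_(j <- r) (x j - v j)).
  apply: eq_spanned (spannedS _ _ (H _ (enum_uniq (mem J)))) => //.
    by move=> x _; rewrite !big_enum.
  move=> al [al1 [j + alj]]; rewrite mem_enum => jJ.
  split.
  - by move=> k _; rewrite (leq_trans (al1 k)) // leq_b1.
  - by exists j.
  - by move=> k /negPf kJ; rewrite (leq_trans (al1 k)) // mem_enum kJ.
elim: r => [_|k r IH /= /andP[kr ur]].
  by apply: Spanned0 => x _; rewrite !big_nil subrr.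
have sk := spanned_linear predT k (0 : K).
have sr := spanned_scale (v k) (spanned_prod (r := r) (P := xpredT) (F := fun j x => x j - v j)
    (fun j _ _ => spanned_linear predT j (v j))).
apply: eq_spanned (spanned_add
    (spanned_mul (B := fun al => [/\ forall j, (al j <= (j \in k :: r))%N
        & exists2 j, j \in k :: r & al j = 0%N]) _ sk (IH ur))
    (spannedS _ _ sr)) => // [x _|al be Bal [Bbe [j jr bj]]|al Bal].
- by rewrite !big_cons; set p1 := \prod_(_ <- _) _; set p2 := \prod_(_ <- _) _; ring.
- split=> [i|]; last first.
    exists j; first by rewrite inE jr orbT.
    have := Bal j; case: eqP => [e|_]; first by move: kr; rewrite -e jr.
    by rewrite leqn0 bj addn0 => /eqP.
  rewrite inE; have := Bal i; have := Bbe i; case: eqP => [->|_] /=.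
    by rewrite (negPf kr) leqn0 => /eqP ->; rewrite addn0.
  by move=> + /[!leqn0]/eqP ->.
have cnt j : (\sum_(i <- r) (j == i) = (j \in r) :> nat)%N.
  rewrite -(count_uniq_mem _ ur) -sum1_count [RHS]big_mkcond /=.
  by apply: eq_bigr => i _; rewrite eq_sym; case: (_ == _).
split=> [j|]; first by rewrite (leq_trans (Bal j)) // cnt inE; case: (j \in r); rewrite ?orbT.
by exists k; [rewrite mem_head | apply/eqP; rewrite -leqn0 (leq_trans (Bal k)) // cnt (negPf kr)].
Qed.

(** Multiplying the Bezout identity for the coordinates outside J by the product
    of the x j over J turns each term into [g i] times a full product
    [b i], up to the error of replacing x j by x j - a i j on J. *)
Lemma prod_below (S : {pred {ffun I -> K}}) (b : I -> K) (J : {set I}) :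
    (forall x, x \in S -> forall i, \prod_j (x j - a i j) = b i) -> J != set0 ->
  spanned S (below J #|I|.+1) (fun x => \prod_(j in J) x j).
Proof.
move=> Sb J0; have [j0 j0J] := set0Pn _ J0.
have [|g [sg g1]] := products_bezout (Q := ~: J) (E := setT).
  by rewrite cardsT -(cardsC J) -[X in (X < _)%N]add0n ltn_add2r card_gt0.
apply: (@eq_spanned _ _ _ _ (fun x => \sum_i g i x * (b i + \prod_(k in ~: J) (x k - a i k)
   * (\prod_(j in J) x j - \prod_(j in J) (x j - a i j))))).
  move=> x xS.
  transitivity ((\sum_(i in [set: I]) g i x * \prod_(k in ~: J) (x k - a i k)) *
    \prod_(j in J) x j); first by rewrite g1 mul1r.
  rewrite mulr_suml; apply: eq_big => [i|i _].
    by rewrite inE.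
  have := Sb x xS i; rewrite (bigID (fun j => j \in J)) /= => <-.
  rewrite (eq_bigl (fun k => k \notin J)); last by move=> k; rewrite inE.
  set p1 := \prod_(j in J) _; set p2 := \prod_(j | j \notin J) _.
  set p3 := \prod_(j in J) _; ring.
apply: spanned_sum => i _.
have sP := spanned_prod (r := index_enum I) (P := fun k => k \in ~: J)
  (fun k _ _ => spanned_linear predT k (a i k)).
have cnt j : (\sum_(k in ~: J) (j == k) = (j \notin J) :> nat)%N.
  case jJ: (j \in J); last first.
    rewrite (bigD1 j) ?inE ?jJ //= eqxx big1 // => k /andP[_ /negPf].
    by rewrite eq_sym => ->.
  rewrite big1 // => k; rewrite inE => /negP kJ; case: eqP => // jk.
  by rewrite -jk jJ in kJ.
have {}sP : spanned S (box (fun j => (j \notin J) : nat)) (fun x => \prod_(k in ~: J) (x k - a i k)).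
  by apply: spannedS sP => // al Bal j; rewrite -cnt.
have sl := spannedS (S' := S) (fun _ _ => isT) (fun _ h => h) (prod_shift_below (a i) J).
have {sl}sP : spanned S (below J 1) (fun x => b i + \prod_(k in ~: J) (x k - a i k)
   * (\prod_(j in J) x j - \prod_(j in J) (x j - a i j))).
  apply: spanned_add.
    apply: spannedS (spanned_const S (b i)) => // al Bal.
    split=> [j _||j _]; [|exists j0 => //|]; try by rewrite (leq_trans (Bal _)).
    by apply/eqP; rewrite -leqn0.
  apply: spanned_mul sP sl => al be Bal [b1 [j jJ bj] b0]; split=> [k kJ||k kJ].
  - by have := Bal k; rewrite kJ leqn0 => /eqP ->; apply: b1.
  - by exists j => //; have := Bal j; rewrite jJ leqn0 bj addn0 => /eqP.
  - by have := Bal k; have := b0 k kJ; rewrite kJ leqn0 => /eqP ->; rewrite addn0.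
apply: spanned_mul (spannedS _ (fun _ h => h) (sg i)) sP => // al be Bal [b1 [j jJ bj] b0].
split=> [k kJ||k kJ].
- by have := Bal k; rewrite inE kJ leqn0 => /eqP ->; apply: b1.
- by exists j => //; have := Bal j; rewrite inE jJ leqn0 bj addn0 => /eqP.
- by have := Bal k; have := b0 k kJ; rewrite inE kJ /=; lia.
Qed.

End ProductSystem.

(** The increments are such that lowering by one a coordinate above
    [threshold m r.+1] decreases the sum of squares of the exponents more than
    raising all coordinates below [threshold m r] by m + 1 increases it. *)
Fixpoint threshold (m r : nat) : nat :=
  if r is r'.+1 then
    (threshold m r' + m * (2 * threshold m r' * m.+1 + m.+1 ^ 2))%N
  else 0%N.

Lemma leq_threshold m r r' : (r <= r')%N -> (threshold m r <= threshold m r')%N.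
Proof.
elim: r' => [|r' IH]; first by rewrite leqn0 => /eqP->.
by rewrite leq_eqVlt => /orP[/eqP->|] // /IH /=; lia.
Qed.

(** Otherwise each of the #|I| intervals between consecutive thresholds contains
    a coordinate, which leaves none for the one above the last threshold. *)
Lemma threshold_gap (I : finType) (al : I -> nat) j0 :
    (threshold #|I| #|I| < al j0)%N ->
  exists r : 'I_#|I|,
    forall j, (al j <= threshold #|I| r)%N || (threshold #|I| r.+1 < al j)%N.
Proof.
set m := #|I| => lj0.
case: (boolP [exists r : 'I_m, [forall j, (al j <= threshold m r)%N ||
    (threshold m r.+1 < al j)%N]]) => [/existsP[r /forallP rP]|]; first by exists r.
rewrite negb_exists => /forallP nr.
have [f fP] : exists f : 'I_m -> I, forall r : 'I_m, (threshold m r < al (f r) <= threshold m r.+1)%N.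
  apply: (fin_all_exists (P := fun r j => threshold m (r : 'I_m) < al j <= threshold m r.+1)%N) => r.
  have := nr r; rewrite negb_forall => /existsP[j].
  by rewrite negb_or -ltnNge -leqNgt => jP; exists j.
have injf : injective f.
  suff H (r r' : 'I_m) : (r < r')%N -> f r != f r'.
    move=> r r' e; apply: val_inj; case: (ltngtP r r') => // /H; rewrite e ?eqxx //.
  move=> rr'; apply/eqP => e; have := fP r; have := fP r'.
  by rewrite -e; have := leq_threshold m rr'; rewrite /=; lia.
have : j0 \in codom f by apply: inj_card_onto => //; rewrite card_ord.
case/codomP => r e; have := fP r; rewrite -e.
by have := leq_threshold m (ltn_ord r); lia.
Qed.

Section ProductSystemBound.
Variables (K : fieldType) (I : finType) (a : I -> I -> K) (b : I -> K).
Hypothesis inj_a : forall k, injective (a^~ k).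
Let m := #|I|.

(** A monomial with a large exponent is rewritten by [prod_below], J being the
    set of coordinates above a gap between thresholds. The sum of the squares
    of the exponents decreases, so that the process stops. *)
Lemma spanned_small (S : {pred {ffun I -> K}}) al :
    (forall x, x \in S -> forall i, \prod_j (x j - a i j) = b i) ->
  spanned S (box (fun=> threshold m m)) (monomial al).
Proof.
move=> Sb; have [n] := ubnP (\sum_j al j ^ 2)%N; elim: n al => // n IH al nal.
have [/forallP sal|] := boolP [forall j, (al j <= threshold m m)%N].
  apply: eq_spanned (spanned_monomial S 1 (al := al) _) => [x _|j]; last exact: sal.
  by rewrite mul1r.
rewrite negb_forall => /existsP[j0]; rewrite -ltnNge => lj0.
have [r rP] := threshold_gap lj0.
(* The coordinates above the gap; all others are at most threshold m r. *)
pose J := [set j | threshold m r.+1 < al j]%N.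
have j0J : j0 \in J by rewrite inE (leq_ltn_trans _ lj0) // leq_threshold.
have J0 : J != set0 by apply/set0Pn; exists j0.
(* One factor x j is taken out for each j in J and rewritten. *)
pose al' j := (al j - (j \in J))%N.
have sp : spanned S (fun ga => exists2 be, below J m.+1 be & forall j, ga j = al' j + be j)%N (monomial al).
  apply: eq_spanned (spanned_mul _ (spanned_monomial S 1 (al := al')
    (B := fun be => forall j, be j = al' j) _) (prod_below inj_a Sb J0)) => //.
    move=> x _; rewrite mul1r /monomial [X in _ * X]big_mkcond -big_split /=.
    apply: eq_bigr => j _; rewrite /al'; case: (boolP (j \in J)) => jJ.
      by rewrite -exprSr subn1 prednK //; move: jJ; rewrite inE; lia.
    by rewrite subn0 mulr1.
  by move=> be ga bE Bga; exists ga => // j; rewrite bE.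
apply: spanned_trans sp => ga [be [be1 [j1 j1J bj1] be0] gaE].
apply: IH; rewrite ltnS in nal; apply: leq_trans nal.
pose c := (2 * threshold m r * m.+1 + m.+1 ^ 2)%N.
have gaP j : (ga j ^ 2 <= al j ^ 2 + c)%N.
  rewrite gaE /al'; case: (boolP (j \in J)) => jJ.
    apply: (@leq_trans (al j ^ 2)); last exact: leq_addr.
    rewrite leq_sqr; have := be1 j jJ; move: jJ; rewrite inE; lia.
  have := rP j; move: (jJ); rewrite inE => /negPf -> /[!orbF] alj.
  have := be0 j jJ; rewrite /c subn0 -/m => bj.
  have h1 : (be j ^ 2 <= m.+1 ^ 2)%N by rewrite leq_sqr.
  have h2 : (al j * be j <= threshold m r * m.+1)%N by apply: leq_mul.
  rewrite sqrnD -!mulnA; move: h1 h2; move: (_ * _)%N (_ * _)%N (_ ^ _)%N (_ ^ _)%N (_ ^ _)%N; lia.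
have j1P : (ga j1 ^ 2 + 2 * threshold m r.+1 < al j1 ^ 2)%N.
  rewrite gaE /al' j1J bj1 addn0; move: j1J; rewrite inE.
  by move: (threshold m r.+1) => t; case: (al j1) => // z; rewrite subn1 /= => h; nia.
rewrite (bigD1 j1) //= [X in (_ < X)%N](bigD1 j1) //=.
have : (\sum_(j | j != j1) ga j ^ 2 <= \sum_(j | j != j1) al j ^ 2 + m * c)%N.
  apply: (@leq_trans (\sum_(j | j != j1) (al j ^ 2 + c))); first exact: leq_sum.
  rewrite big_split leq_add2l /= sum_nat_const leq_mul2r; apply/orP; right.
  exact: max_card.
by move: j1P; rewrite /= -/c; lia.
Qed.

(** The indicator of a solution p among the others is a polynomial function, a
    product of one linear factor for each other solution; so it is spanned by
    the small monomials. *)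
Lemma product_system_bound (s : seq {ffun I -> K}) : uniq s ->
    (forall x, x \in s -> forall i, \prod_j (x j - a i j) = b i) ->
  (size s <= (threshold m m).+1 ^ m)%N.
Proof.
move=> us sb; apply: card_spanned => // p ps.
(* d q is a coordinate in which q differs from p. *)
have [d dP] : exists d : {ffun I -> K} -> option I, forall q, q != p ->
    if d q is Some j then p j != q j else false.
  exists (fun q => [pick j | p j != q j]) => q qp; case: pickP => // e.
  by case/eqP: qp; apply/ffunP => j; apply/eqP; rewrite eq_sym; apply: negbFE (e j).
pose F q (x : {ffun I -> K}) :=
  if d q is Some j then (p j - q j)^-1 * (x j - q j) else 1.
have sF q : q \in s -> q != p ->
    spanned (mem s) (box (if d q is Some j then fun k => (k == j) : nat else fun=> 0%N)) (F q).
  move=> _ _; rewrite /F; case: (d q) => [j|]; last exact: spanned_const.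
  exact: spanned_scale (spanned_linear _ _ _).
apply: spanned_trans (eq_spanned _ (spanned_prod sF)).
  by move=> al _; apply: spanned_small => x; apply: sb.
move=> x xs /=; have [->|xp] := eqVneq x p.
  rewrite big1 // => q qp; rewrite /F; have := dP q qp; case: (d q) => // j.
  by rewrite -subr_eq0 => /mulVf.
rewrite (big_rem x) //= xp /F; have := dP x xp; case: (d x) => // j _.
by rewrite subrr mulr0 mul0r.
Qed.

End ProductSystemBound.

End ProductSystems.

(** * The norm of a finite field *)

Section FieldNorm.
Local Open Scope ring_scope.

Definition norm_system_bound (s : nat) : nat := (threshold s s).+1 ^ s.

Section Norm.
Variables (K : finFieldType) (q s : nat).
(** The product of the q^j-th powers of x for j < s, which is the norm of x over
    the subfield with q elements when K has q^s elements. *)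
Definition field_norm (x : K) : K := x ^+ (\sum_(j < s) q ^ j).

(** By additivity of the q^j-th powers, the norm of y + al i is the product over
    j of y^(q^j) + (al i)^(q^j): a system of products of linear forms in the
    conjugates of y, which the conjugate j = 0 determines. *)
Lemma norm_system (al b : 'I_s -> K) : [pchar K].-nat q -> injective al -> (0 < s)%N ->
  (#|[set y | [forall i, field_norm (y + al i)%R == b i]]| <= norm_system_bound s)%N.
Proof.
move=> chq inj_al s0; set Y := [set y | _].
have chX j : [pchar K].-nat (q ^ j)%N by rewrite pnatX chq.
pose pt y : {ffun 'I_s -> K} := [ffun j => y ^+ (q ^ (j : 'I_s))].
have inj_pt : injective pt.
  by move=> y z /ffunP /(_ (Ordinal s0)); rewrite !ffunE expn0 !expr1.
have upt : uniq [seq pt y | y <- enum Y] by rewrite map_inj_uniq ?enum_uniq.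
pose a i j := - al i ^+ (q ^ (j : 'I_s)).
have inj_a k : injective (a^~ k).
  move=> i i' /oppr_inj e; apply: inj_al; apply/eqP; rewrite -subr_eq0.
  have: (al i - al i' + al i') ^+ (q ^ k) = al i' ^+ (q ^ k) by rewrite subrK e.
  rewrite exprDn_pchar // => /eqP; rewrite -subr_eq0 addrK expf_eq0.
  by case/andP.
have := product_system_bound (a := a) (b := b) inj_a upt.
rewrite size_map -cardE /norm_system_bound card_ord; apply.
move=> _ /mapP[y + ->] i; rewrite mem_enum inE => /forallP/(_ i)/eqP <-.
rewrite /field_norm -prodrXr; apply: eq_bigr => j _.
by rewrite ffunE opprK -exprDn_pchar.
Qed.

(** For a generator g of the multiplicative group, the norm of g^i is g^(M i)
    with M = (q^s - 1) / (q - 1), and it does not change when i increases by a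
    multiple of q - 1. *)
Lemma norm_fibers : (1 < q)%N -> #|K| = (q ^ s)%N -> (0 < s)%N ->
  exists bb : nat -> K,
    {in gtn q.-1 &, injective bb} /\
    forall i, (i < q.-1)%N -> (q ^ s.-1 <= #|[set x | field_norm x == bb i]|)%N.
Proof.
move=> q1 cK s0; set M := (\sum_(j < s) q ^ j)%N.
have qM : (q.-1 * M = (q ^ s).-1)%N by rewrite predn_exp.
have qs1 : (1 < q ^ s)%N by rewrite -(expn0 q) ltn_exp2l.
pose d := (q ^ s).-1.
have d0 : (0 < d)%N by rewrite /d; lia.
have /hasP[g _ gd] : has (d.-primitive_root) (enum (fun x : K => x != 0)).
  apply: has_prim_root => //.
  - apply/allP => x; rewrite mem_enum unity_rootE => x0.
    rewrite -(inj_eq (mulfI x0)) -exprS mulr1 prednK ?(ltnW qs1) // -cK.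
    by rewrite expf_card.
  - exact: enum_uniq.
  - rewrite -cardE; have := cardC1 (0 : K); rewrite cK /d => <-.
    by apply: subset_leq_card; apply/subsetP => x; rewrite !inE.
have eqg i j : (i < d)%N -> (j < d)%N -> g ^+ i = g ^+ j -> i = j.
  move=> id jd /eqP; rewrite (eq_prim_root_expr gd) !modn_small //.
  by move/eqP.
have M0 : (q ^ s.-1 <= M)%N.
  by rewrite /M -(prednK s0) big_ord_recr /= leq_addl.
exists (fun i => g ^+ (M * i)); split=> [i j iq jq e|i iq].
  rewrite !inE in iq jq; have M1 : (0 < M)%N by rewrite (leq_trans _ M0) // expn_gt0; lia.
  by have := eqg (M * i)%N (M * j)%N; rewrite /d -qM => /(_ _ _ e); nia.
apply: leq_trans M0 _; rewrite -[X in (X <= _)%N]card_ord.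
rewrite -(card_imset predT (f := fun k : 'I_M => g ^+ (i + q.-1 * k))) /=; last first.
  move=> k k' /eqg e; apply: val_inj => /=; have := ltn_ord k; have := ltn_ord k'.
  have lt (k0 : 'I_M) : (i + q.-1 * k0 < d)%N.
    rewrite /d -qM; apply: (@leq_trans (q.-1 * k0.+1)); last by rewrite leq_mul2l ltn_ord orbT.
    by rewrite mulnS ltn_add2r.
  move=> _ _; move/eqP: (e (lt k) (lt k')).
  by rewrite eqn_add2l eqn_mul2l => /orP[|/eqP //]; lia.
apply: subset_leq_card; apply/subsetP => _ /imsetP[k _ ->].
rewrite inE /field_norm -/M -exprM.
have -> : ((i + q.-1 * k) * M = M * i + d * k)%N by rewrite /d -qM; ring.
by rewrite exprD [g ^+ (d * k)]exprM (prim_expr_order gd) expr1n mulr1.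
Qed.

End Norm.

End FieldNorm.

(** * Embeddings, copies and complete bipartite graphs *)

Lemma edge_card2 (T : finType) (G : sgraph T) (e : {set T}) : e \in edges G -> #|e| = 2.
Proof. by case: G => E /= /forall_inP h /h/eqP. Qed.

Definition adj (T : finType) (G : sgraph T) : rel T :=
  fun u v => [set u; v] \in edges G.

Lemma adj_sym (T : finType) (G : sgraph T) : symmetric (adj G).
Proof. by move=> u v; rewrite /adj setUC. Qed.

Lemma adj_neq (T : finType) (G : sgraph T) u v : adj G u v -> u != v.
Proof. by move/edge_card2; rewrite cards2; case: eqP. Qed.

Lemma edge_adj (T : finType) (G : sgraph T) (e : {set T}) :
  e \in edges G -> exists u v, e = [set u; v] /\ adj G u v.
Proof.
move=> eG; have /cards2P[u [v [_ euv]]] : #|e| == 2 by rewrite (edge_card2 eG).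
by exists u, v; rewrite /adj -euv.
Qed.

Lemma copies_of_embedding (V T : finType) (F : sgraph V) (G : sgraph T)
    (f : {ffun V -> T}) : injective f -> (forall u v, adj F u v -> adj G (f u) (f v)) ->
  (f @: [set: V], [set f @: e | e : {set V} in edges F]) \in copies F G.
Proof.
move=> injf fadj; rewrite inE; apply/andP; split; last first.
  by apply/existsP; exists f; rewrite !eqxx !andbT; apply/injectiveP.
apply/andP; split=> /=; last first.
  by apply/forall_inP => _ /imsetP[e _ ->]; apply: imsetS; apply: subsetT.
apply/subsetP => _ /imsetP[e /edge_adj[u [v [-> uv]]] ->].
by rewrite imsetU1 imset_set1; apply: fadj.
Qed.

Lemma embedding_of_copies (V T : finType) (F : sgraph V) (G : sgraph T) S :
    S \in copies F G ->
  exists f : {ffun V -> T}, [/\ injective f, forall u v, adj F u v -> adj G (f u) (f v)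
    & S = (f @: [set: V], [set f @: e | e : {set V} in edges F])].
Proof.
rewrite inE => /andP[/andP[/subsetP S2 _] /existsP[f /and3P[/injectiveP injf /eqP e1 /eqP e2]]].
exists f; split=> // [u v uv|]; last by rewrite e1 e2; case: S {S2 e1 e2}.
have /S2 : f @: [set u; v] \in S.2 by rewrite -e2 imset_f.
by rewrite imsetU1 imset_set1.

Qed.

Section RelGraph.
Variables (T : finType) (r : rel T).

Fact rel_graph_subproof :
  [forall e in [set [set p.1; p.2] | p : T * T & (p.1 != p.2) && r p.1 p.2], #|e| == 2].
Proof. by apply/forall_inP => _ /imsetP[p /[!inE]/andP[p12 _] ->]; rewrite cards2 p12. Qed.

Definition rel_graph : sgraph T := SGraph rel_graph_subproof.

Lemma adj_rel_graph u v : symmetric r -> adj rel_graph u v = (u != v) && r u v.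
Proof.
move=> symr; apply/imsetP/idP => [[[a b] /[!inE] /= /andP[ab rab] e]|uv]; last first.
  by exists (u, v); rewrite ?inE.
have : u \in [set a; b] by rewrite -e !inE eqxx.
have : v \in [set a; b] by rewrite -e !inE eqxx orbT.
have : #|[set u; v]| = 2 by rewrite e cards2 ab.
rewrite cards2 !inE; case: (eqVneq u v) => //= uv _ /orP[]/eqP va /orP[]/eqP ua; move: uv.
- by rewrite ua va eqxx.
- by rewrite ua va symr rab.
- by rewrite ua va rab.
- by rewrite ua va eqxx.
Qed.
End RelGraph.

Definition biclique_rel (s t : nat) : rel ('I_s + 'I_t) := fun a b =>
  match a, b with inl _, inr _ | inr _, inl _ => true | _, _ => false end.

Definition biclique (s t : nat) : sgraph ('I_s + 'I_t)%type := rel_graph (@biclique_rel s t).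

Lemma adj_biclique s t a b : adj (biclique s t) a b = biclique_rel a b.
Proof.
rewrite adj_rel_graph; last by move=> [?|?] [?|?].
by case: a b => [a|a] [b|b] //=; rewrite andbF.
Qed.

Definition common_nbrs (T : finType) (G : sgraph T) (Y : {set T}) : {set T} :=
  [set z | [forall y in Y, adj G y z]].

(** Containment of K_(s,t) is used only through the numbers of common neighbours
    of sets of s vertices. *)
Lemma free_of_biclique s t (T : finType) (G : sgraph T) :
  reflect (forall Y : {set T}, #|Y| = s -> #|common_nbrs G Y| < t)
          (free_of (biclique s t) G).
Proof.
apply: (iffP eqP) => [fr Y cY|lt].
  rewrite ltnNge; apply/negP => tZ; set Z := common_nbrs G Y in tZ.
  pose y (i : 'I_s) := enum_val (cast_ord (esym cY) i).
  pose z (j : 'I_t) := enum_val (widen_ord tZ j).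
  have yz i j : adj G (y i) (z j).
    by have := enum_valP (widen_ord tZ j); rewrite inE => /forall_inP; apply; apply: enum_valP.
  pose f : {ffun 'I_s + 'I_t -> T} := [ffun a => match a with inl i => y i | inr j => z j end].
  suff : (f @: setT, [set f @: e | e : {set ('I_s + 'I_t)} in edges (biclique s t)])
      \in copies (biclique s t) G by rewrite fr inE.
  apply: copies_of_embedding => [a b|a b].
    rewrite !ffunE; case: a b => [i|j] [i'|j'] e.
    - by congr inl; move/enum_val_inj/cast_ord_inj: e.
    - by have := adj_neq (yz i j'); rewrite e eqxx.
    - by have := adj_neq (yz i' j); rewrite e eqxx.
    - by congr inr; apply: val_inj; move/enum_val_inj/(congr1 val): e.
  rewrite adj_biclique !ffunE; case: a b => [i|j] [i'|j'] //= _.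
  by rewrite adj_sym.
apply/setP => S; rewrite !inE; apply/negP => SC.
have [f [injf fadj _]] : exists f : {ffun 'I_s + 'I_t -> T}, [/\ injective f,
    forall u v, adj (biclique s t) u v -> adj G (f u) (f v) & S = (f @: [set: _], 
    [set f @: e | e : {set ('I_s + 'I_t)} in edges (biclique s t)])].
  by apply: embedding_of_copies; rewrite inE.
have := lt [set f (inl i) | i : 'I_s].
rewrite card_imset ?card_ord => [|i i' /injf[]] // /(_ erefl).
rewrite ltnNge => /negP; apply.
rewrite -[X in X <= _]card_ord -(card_imset predT (f := fun j => f (inr j))) => [|j j' /injf[]] //.
apply: subset_leq_card; apply/subsetP => _ /imsetP[j _ ->].
rewrite inE; apply/forall_inP => _ /imsetP[i _ ->].
by apply: fadj; rewrite adj_biclique.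
Qed.

(** * Shifted norm graphs *)

Section NormGraphs.
Local Open Scope ring_scope.

(** The labellings x for which the vertices (u, x u) span a copy of F in the
    graph of [shifted_norm_rel] below. *)
Definition norm_labellings (V : finType) (F : sgraph V) (K : finFieldType)
    (q s : nat) (b c : {set V} -> K) : {set {ffun V -> K}} :=
  [set x : {ffun V -> K} |
    [forall e in edges F, field_norm q s (\sum_(u in e) x u + c e) == b e]].

Section NormGraph.
Variables (V : finType) (F : sgraph V) (K : finFieldType) (q s n : nat).
Variables (b c : {set V} -> K) (place : V * K -> 'I_n).
Hypotheses (chq : [pchar K].-nat q) (s0 : (0 < s)%N) (inj_b : injective b)
  (inj_place : injective place).

Definition shifted_norm_rel : rel (V * K) := fun p r =>
  adj F p.1 r.1 && (field_norm q s (p.2 + r.2 + c [set p.1; r.1]) == b [set p.1; r.1]).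

Lemma shifted_norm_rel_sym : symmetric shifted_norm_rel.
Proof. by move=> p r; rewrite /shifted_norm_rel adj_sym setUC [p.2 + _]addrC. Qed.

(** The common neighbours lying in the copy of K indexed by a fixed w solve a
    system of s norm equations. Its shifts are distinct as soon as it has a
    solution: two vertices of Y with equal shifts lie over different vertices
    of F, hence belong to different edges at w, where the norm takes different
    values. *)
Lemma shifted_norm_rel_nbrs (Y : {set V * K}) : #|Y| = s ->
  (#|[set z | [forall y in Y, shifted_norm_rel y z]]| <= #|V| * norm_system_bound s)%N.
Proof.
move=> cY; set Z := [set z | _].
pose h (i : 'I_s) : V * K := enum_val (cast_ord (esym cY) i).
have hY i : h i \in Y by apply: enum_valP.
have inj_h : injective h by move=> i j /enum_val_inj/cast_ord_inj.
pose Zw w := [set z | (w, z) \in Z].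
have cZ : (#|Z| <= \sum_w #|Zw w|)%N.
  rewrite (eq_bigr (fun w => \sum_(z in Zw w) 1)%N) => [|w _]; last by rewrite sum1_card.
  rewrite pair_big_dep /= sum1_card; apply: subset_leq_card; apply/subsetP => -[w z] wz.
  by rewrite unfold_in /=; change (z \in Zw w); rewrite inE.
apply: leq_trans cZ _; rewrite -sum_nat_const; apply: leq_sum => w _.
have [->|[y0 y0Z]] := set_0Vmem (Zw w); first by rewrite cards0.
have adjw z i : z \in Zw w -> shifted_norm_rel (h i) (w, z).
  by rewrite !inE => /forall_inP; apply.
pose al i := (h i).2 + c [set (h i).1; w].
have inj_al : injective al.
  move=> i j e; apply: inj_h.
  have /andP[/= ai /eqP ni] := adjw _ i y0Z; have /andP[/= aj /eqP nj] := adjw _ j y0Z.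
  have e1 : (h i).1 = (h j).1.
    have : b [set (h i).1; w] = b [set (h j).1; w].
      by rewrite -ni -nj ![_ + y0]addrC -!addrA -/(al i) -/(al j) e.
    move/inj_b => e2; have : (h i).1 \in [set (h j).1; w] by rewrite -e2 !inE eqxx.
    by rewrite !inE (negPf (adj_neq ai)) orbF => /eqP.
  move: e; rewrite /al e1 => /addIr; move: e1.
  by case: (h i) (h j) => [? ?] [? ?] /= -> ->.
apply: leq_trans (norm_system (fun i => b [set (h i).1; w]) chq inj_al s0).
apply: subset_leq_card; apply/subsetP => z zZ; rewrite inE; apply/forallP => i.
by have /andP[_ /=] := adjw _ i zZ; rewrite [_ + z]addrC -addrA.
Qed.

(** The norm graph is transported along the injection [place] into the n vertices
    required, the vertices outside the image being isolated. *)
Definition norm_graph_rel : rel 'I_n := fun i j =>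
  [exists p, exists r, [&& place p == i, place r == j & shifted_norm_rel p r]].

Definition norm_graph : sgraph 'I_n := rel_graph norm_graph_rel.

Lemma adj_norm_graphP i j :
  reflect (exists p r, [/\ i = place p, j = place r & shifted_norm_rel p r])
          (adj norm_graph i j).
Proof.
have sym : symmetric norm_graph_rel.
  by move=> x y; apply/existsP/existsP => -[p /existsP[r /and3P[e1 e2 pr]]];
    exists r; apply/existsP; exists p; rewrite e1 e2 shifted_norm_rel_sym.
rewrite adj_rel_graph //; apply: (iffP andP) => [[_ /existsP[p /existsP[r]]]|[p [r [-> -> pr]]]].
  by case/and3P => /eqP <- /eqP <- pr; exists p, r.
split; last by apply/existsP; exists p; apply/existsP; exists r; rewrite !eqxx.
rewrite (inj_eq inj_place); case/andP: pr => /adj_neq pr _.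
by apply: contra pr => /eqP ->.
Qed.

Lemma norm_graph_biclique_free :
  free_of (biclique s (#|V| * norm_system_bound s).+1) norm_graph.
Proof.
apply/free_of_biclique => Y cY; rewrite ltnS.
have [->|[z0 z0P]] := set_0Vmem (common_nbrs norm_graph Y); first by rewrite cards0.
have Yplace y : y \in Y -> exists p, y = place p.
  by move: z0P; rewrite inE => /forall_inP h /h/adj_norm_graphP[p [r [-> _ _]]]; exists p.
have cY' : #|place @^-1: Y| = s.
  rewrite -cY -(card_imset _ inj_place); apply: eq_card => y; apply/imsetP/idP.
    by case=> p; rewrite inE => py ->.
  by move=> yY; have [p e] := Yplace _ yY; exists p; rewrite ?inE -?e.
apply: leq_trans (shifted_norm_rel_nbrs cY'); rewrite -(card_imset _ inj_place).
apply: subset_leq_card; apply/subsetP => z; rewrite inE => /forall_inP zY.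
have [y yY] : exists y, y \in Y by apply/card_gt0P; rewrite cY.
have /adj_norm_graphP[_ [r [_ zr _]]] := zY y yY.
apply/imsetP; exists r => //; rewrite inE; apply/forall_inP => p; rewrite inE => /zY.
case/adj_norm_graphP => p' [r' [/inj_place -> + pr]].
by rewrite zr => /inj_place ->.
Qed.

Lemma norm_graph_copies :
  (#|norm_labellings F q s b c| <= #|copies F norm_graph|)%N.
Proof.
pose f (x : {ffun V -> K}) : {ffun V -> 'I_n} := [ffun u => place (u, x u)].
pose copy x := (f x @: [set: V], [set f x @: e | e : {set V} in edges F]).
rewrite -(card_imset _ (f := copy)).
  apply: subset_leq_card; apply/subsetP => _ /imsetP[x /[!inE]/forall_inP xP ->].
  have := @copies_of_embedding _ _ F norm_graph (f x); rewrite inE; apply.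
    by move=> u v; rewrite !ffunE => /inj_place[].
  move=> u v uv; apply/adj_norm_graphP; exists (u, x u), (v, x v).
  rewrite !ffunE; split=> //; rewrite /shifted_norm_rel /= uv.
  by have := xP _ uv; rewrite big_setU1 ?inE ?(adj_neq uv) // big_set1.
move=> x y [/setP e _]; apply/ffunP => u.
have := e (f x u); rewrite imset_f ?inE // => /esym/imsetP[v _].
by rewrite !ffunE => /inj_place[<-].
Qed.

End NormGraph.

(** Averaging over all c: for a fixed labelling x the conditions on the values
    c e, for the edges e, are independent, and each of them holds for at least
    q^(s-1) of the q^s values. *)
Lemma exists_good_shift (V : finType) (F : sgraph V) (K : finFieldType) (q s : nat)
    (b : {set V} -> K) :
    #|K| = (q ^ s)%N -> (0 < s)%N -> (0 < q)%N -> (#|edges F| <= s * #|V|)%N ->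
    (forall e, (q ^ s.-1 <= #|[set x | field_norm q s x == b e]|)%N) ->
  exists c : {set V} -> K,
    (q ^ (s * #|V| - #|edges F|) <= #|norm_labellings F q s b c|)%N.
Proof.
move=> cK s0 q0 EV bP; set P := #|{set V}|.
pose good (x : {ffun V -> K}) (c : {ffun {set V} -> K}) :=
  [forall e in edges F, field_norm q s (\sum_(u in e) x u + c e) == b e].
have EP : (#|edges F| <= P)%N by apply: max_card.
have cgood x : (q ^ (s * P - #|edges F|) <= #|[set c | good x c]|)%N.
  pose A e := [pred z | (e \in edges F) ==> (field_norm q s (\sum_(u in e) x u + z) == b e)].
  have -> : #|[set c | good x c]| = #|family A|.
    by apply: eq_card => c; rewrite inE; apply: eq_forallb => e; rewrite !inE.
  rewrite card_family.
  have -> : foldr muln 1%N [seq #|A e| | e : {set V}] = (\prod_e #|A e|)%N.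
    by rewrite foldrE big_map enumT.
  rewrite (bigID (fun e => e \in edges F)) /=.
  apply: (@leq_trans (\prod_(e in edges F) q ^ s.-1 * \prod_(e | e \notin edges F) q ^ s)).
    rewrite !prod_nat_const [X in (_ * (_ ^ s) ^ X)%N](_ : _ = (P - #|edges F|)%N); last first.
      by rewrite /P -(cardC (mem (edges F))) addKn; apply: eq_card.
    rewrite -!expnM -expnD leq_pexp2l //.
    rewrite mulnBr -(prednK s0) /=; nia.
  apply: leq_mul; apply: leq_prod => e eF.
    have -> : #|A e| = #|[set z | field_norm q s z == b e]|; last exact: bP.
    rewrite -(card_imset (mem (A e)) (addrI (\sum_(u in e) x u))).
    apply: eq_card => z; rewrite [RHS]inE; apply/imsetP/idP => [[y + ->]|zP].
      by rewrite inE eF.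
    exists (z - \sum_(u in e) x u); last by rewrite addrC subrK.
    by rewrite inE eF /= addrC subrK.
  by rewrite -cK; apply: subset_leq_card; apply/subsetP => z _; rewrite inE (negPf eF).
(* tot counts the good pairs (x, c); it is computed in both orders. *)
pose tot := (\sum_x #|[set c | good x c]|)%N.
have totE : tot = (\sum_(c : {ffun {set V} -> K}) #|[set x | good x c]|)%N.
  rewrite /tot; under eq_bigr do rewrite -sum1_card.
  under [RHS]eq_bigr do rewrite -sum1_card.
  rewrite (exchange_big_dep xpredT) //=; apply: eq_bigr => c _.
  by apply: eq_bigl => x; rewrite !inE.
have tot_ge : (q ^ (s * P) * q ^ (s * #|V| - #|edges F|) <= tot)%N.
  have : (#|{ffun V -> K}| * q ^ (s * P - #|edges F|) <= tot)%N.
    by rewrite -sum_nat_const; apply: leq_sum => x _; apply: cgood.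
  rewrite card_ffun cK -expnM -!expnD; apply: leq_trans.
  rewrite leq_pexp2l //; nia.
case: (boolP [exists c : {ffun {set V} -> K},
    (q ^ (s * #|V| - #|edges F|) <= #|[set x | good x c]|)%N]) => [/existsP[c cP]|].
  by exists c.
rewrite negb_exists => /forallP small.
suff : (tot < q ^ (s * P) * q ^ (s * #|V| - #|edges F|))%N by rewrite ltnNge tot_ge.
have -> : (q ^ (s * P) = #|{ffun {set V} -> K}|)%N by rewrite card_ffun cK -expnM.
set B := (q ^ (s * #|V| - _))%N in small *.
have B0 : (0 < B)%N by rewrite expn_gt0 q0.
apply: (@leq_ltn_trans (#|{ffun {set V} -> K}| * B.-1)).
  rewrite totE -sum_nat_const; apply: leq_sum => c _.
  by have := small c; rewrite -ltnNge; lia.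
by rewrite ltn_mul2l prednK // leqnn andbT; apply/card_gt0P; exists [ffun=> 0].
Qed.

End NormGraphs.

(** The bound 2^k > #|{set V}| leaves enough nonzero norm values to give
    different ones to different edges. *)
Lemma exnum_biclique_ge (V : finType) (F : sgraph V) (s k n : nat) :
    0 < s -> 0 < k -> #|edges F| <= s * #|V| -> #|{set V}| < 2 ^ k ->
    #|V| * (2 ^ k) ^ s <= n ->
  (2 ^ k) ^ (s * #|V| - #|edges F|) <=
    exnum n F (biclique s (#|V| * norm_system_bound s).+1).
Proof.
move=> s0 k0 EV Pk Vn.
have ks0 : 0 < k * s by rewrite muln_gt0 k0.
(* The field with (2^k)^s elements. *)
have [K ch2 cK] := pPrimePowerField (isT : prime 2) ks0; rewrite expnM in cK.
have q1 : 1 < 2 ^ k by rewrite -[1](expn0 2) ltn_exp2l.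
have [bb [inj_bb bbP]] := norm_fibers q1 cK s0.
have rk (e : {set V}) : enum_rank e < (2 ^ k).-1.
  by apply: leq_trans (ltn_ord _) _; rewrite -ltnS prednK ?expn_gt0.
pose b (e : {set V}) := bb (enum_rank e).
have inj_b : injective b.
  by move=> e e' /inj_bb h; apply/enum_rank_inj/val_inj/h; rewrite inE rk.
have bP (e : {set V}) : (2 ^ k) ^ s.-1 <= #|[set x | field_norm (2 ^ k) s x == b e]|.
  exact/bbP/rk.
have [c cP] := exists_good_shift (F := F) cK s0 (ltnW q1) EV bP.
have cVK : #|{: V * K}| <= n by rewrite card_prod cK.
pose place (p : V * K) : 'I_n := widen_ord cVK (enum_rank p).
have inj_place : injective place.
  by move=> p r /(congr1 val) /= /val_inj /enum_rank_inj.
have chq : [pchar K]%R.-nat (2 ^ k).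
  by rewrite (eq_pnat _ (GRing.pcharf_eq ch2)) pnatX pnat_id.
apply: leq_trans cP _; apply: leq_trans (norm_graph_copies F (2 ^ k) s b c inj_place) _.
exact/leq_bigmax_cond/norm_graph_biclique_free.
Qed.

(** * Counting inequalities in biclique-free graphs *)

Lemma exp_le_ffact a k : 2 * k <= a -> a ^ k <= 2 ^ k * a ^_ k.
Proof.
move=> ka; suff H j : j <= k -> a ^ j <= 2 ^ j * a ^_ j by apply: H.
elim: j => [|j IH] jk; first by rewrite !expn0 ffactn0.
rewrite !expnSr ffactnSr mulnACA; apply: leq_mul; first exact/IH/ltnW.
lia.
Qed.

Lemma ffact_le_exp m k : m ^_ k <= m ^ k.
Proof.
by elim: k => [|k IH]; rewrite ?ffactn0 // ffactnSr expnSr leq_mul // leq_subr.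
Qed.

Section Capacity.
Variables (T : finType) (G : sgraph T) (t k : nat).

(** The form taken by K_(s,t)-freeness inside a candidate set D, where A is the
    set of vertices still available. Once p images have been chosen among the
    vertices adjacent to all of D, it holds with k = s - p. *)
Definition capacity (A D : {set T}) := forall Y : {set T},
  Y \subset A -> #|Y| = k -> #|D :&: common_nbrs G Y| <= t.

(** Double counting of the pairs (x, Y) where Y is a set of k vertices of N x.
    Degrees below 2k are left out because the k-th power of such a degree is
    not controlled by the number of its k-subsets. *)
Lemma sum_exp_degrees (A D B : {set T}) (N : T -> {set T}) :
    capacity A D -> B \subset A ->
    (forall x, N x \subset B) -> (forall x y, y \in N x -> adj G x y) ->
  \sum_(x in D | 2 * k <= #|N x|) #|N x| ^ k <= 2 ^ k * t * #|B| ^ k.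
Proof.
move=> cap BA NB NG.
apply: (@leq_trans (2 ^ k * \sum_(x in D) #|N x| ^_ k)).
  rewrite big_distrr /= big_mkcondr /=; apply: leq_sum => x _.
  case: ifP => // /exp_le_ffact; exact.
rewrite -mulnA leq_mul2l; apply/orP; right.
apply: (@leq_trans (t * #|B| ^_ k)); last by rewrite leq_mul2l ffact_le_exp orbT.
under eq_bigr do rewrite -bin_ffact.
rewrite -bin_ffact -big_distrl /= mulnA leq_mul2r; apply/orP; right.
under eq_bigr do rewrite -cards_draws -sum1_card.
rewrite -cards_draws (exchange_big_dep
  (mem [set Y : {set T} | (Y \subset B) && (#|Y| == k)])) /=; last first.
  by move=> x Y _; rewrite !inE => /andP[YN ->]; rewrite (subset_trans YN).
rewrite mulnC -sum_nat_const; apply: leq_sum => Y; rewrite inE => /andP[YB /eqP cY].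
rewrite sum1_card; apply: leq_trans (cap Y (subset_trans YB BA) cY).
apply: subset_leq_card; apply/subsetP => x; rewrite unfold_in /= !inE.
case/andP=> -> /andP[/subsetP YN _]; apply/forall_inP => y /YN /NG.
by rewrite adj_sym.
Qed.

End Capacity.

Section RealBounds.
Variable R : realType.
Local Open Scope ring_scope.

(** Each factor is at most M^(th i), where M is the right-hand side and the
    exponents sum to at most 1. *)
Lemma prod_powR_le1sum (I : eqType) (r : seq I) (b th : I -> R) :
    {in r, forall i, 0 <= b i} -> {in r, forall i, 0 <= th i} ->
    \sum_(i <- r) th i <= 1 ->
  \prod_(i <- r) b i `^ th i <= 1 + \sum_(i <- r) b i.
Proof.
move=> b0 th0 th1; set M := 1 + _.
have sb0 s : {subset s <= r} -> 0 <= \sum_(i <- s) b i.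
  by move=> sr; rewrite big_seq; apply: sumr_ge0 => i /sr/b0.
have M1 : 1 <= M by rewrite lerDl sb0.
have bM i : i \in r -> b i <= M.
  move=> ir; rewrite /M (big_rem i) //= addrCA lerDl addr_ge0 //.
  by apply: sb0 => j /mem_rem.
apply: (@le_trans _ _ (\prod_(i <- r) M `^ th i)).
  rewrite !big_seq; apply: ler_prod => i ir; rewrite powR_ge0 /=.
  by apply: ge0_ler_powR; rewrite ?th0 ?nnegrE ?b0 ?bM // (le_trans ler01).
have -> : \prod_(i <- r) M `^ th i = M `^ (\sum_(i <- r) th i).
  have M0 : M != 0 by rewrite gt_eqF // (lt_le_trans ltr01).
  elim/big_rec2: _ => [|i y1 y2 _ ->]; first by rewrite powRr0.
  by rewrite powRD // M0 implybT.
by rewrite -[leRHS]powRr1 ?(le_trans ler01) // ler_powR.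
Qed.

(** To be summed over d possible values of a. The normalised powers
    d (a i / m i)^k then have average O(1), so that the last factor is O(1) on
    average: this plays the part of the Hoelder inequality, up to a constant. *)
Lemma prod_powR_balance (I : eqType) (r : seq I) (a m lam : I -> R) (d : R) (k : nat) :
    {in r, forall i, 0 <= a i} -> {in r, forall i, 0 < m i} ->
    {in r, forall i, 0 <= lam i} -> 0 < d -> (0 < k)%N ->
    \sum_(i <- r) lam i <= k%:R ->
  \prod_(i <- r) a i `^ lam i <=
    \prod_(i <- r) m i `^ lam i * d `^ (- ((\sum_(i <- r) lam i) / k%:R))
      * (1 + \sum_(i <- r) d * (a i ^+ k / m i ^+ k)).
Proof.
move=> a0 m0 l0 d0 k0 lk.
have kR0 : 0 < k%:R :> R by rewrite ltr0n.
pose b i := d * (a i ^+ k / m i ^+ k).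
have b0 : {in r, forall i, 0 <= b i}.
  by move=> i ir; rewrite mulr_ge0 ?divr_ge0 ?exprn_ge0 ?a0 // ltW // m0.
have := @prod_powR_le1sum _ r b (fun i => lam i / k%:R) b0.
have th0 : {in r, forall i, 0 <= lam i / k%:R}.
  by move=> i ir; rewrite divr_ge0 ?l0 // ltW.
rewrite -mulr_suml ler_pdivrMr // mul1r => /(_ th0 lk) H.
suff -> : \prod_(i <- r) a i `^ lam i = \prod_(i <- r) m i `^ lam i
    * d `^ (- ((\sum_(i <- r) lam i) / k%:R)) * \prod_(i <- r) b i `^ (lam i / k%:R).
  rewrite ler_wpM2l // mulr_ge0 ?powR_ge0 //.
  by apply: prodr_ge0 => i _; apply: powR_ge0.
have -> : d `^ (- ((\sum_(i <- r) lam i) / k%:R)) =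
    \prod_(i <- r) d `^ (- (lam i / k%:R)).
  rewrite mulr_suml -sumrN; elim/big_rec2: _ => [|i y1 y2 _ <-]; first by rewrite powRr0.
  by rewrite powRD // (gt_eqF d0) implybT.
rewrite -!big_split /= !big_seq; apply: eq_bigr => i ir.
have mi := m0 i ir; have ai := a0 i ir.
have q0 : 0 <= a i / m i by rewrite divr_ge0 // ltW.
rewrite /b -expr_div_n powRM ?exprn_ge0 ?(ltW d0) //.
rewrite -powR_mulrn // -powRrM (mulrC k%:R) divfK ?gt_eqF //.
rewrite -!mulrA [X in _ * X]mulrA powRN mulVf ?gt_eqF ?powR_gt0 // mul1r.
by rewrite -powRM ?(ltW mi) // mulrC divfK // gt_eqF.
Qed.

End RealBounds.

(** * The number of embeddings into a biclique-free graph *)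

Section Embeddings.
Variables (V : finType) (F : sgraph V).
Implicit Types (L : seq V).

Definition edges_in L : {set {set V}} := [set e in edges F | e \subset L].

Lemma card_edges_in_cons j L : uniq (j :: L) ->
  #|edges_in (j :: L)| = count (adj F j) L + #|edges_in L|.
Proof.
move=> /= /andP[jL uL].
rewrite -(cardsID [set e : {set V} | j \in e] (edges_in (j :: L))); congr (_ + _); last first.
  apply: eq_card => e; rewrite !inE; case eF: (e \in edges F); rewrite ?andbF //= andbC.
  apply/andP/idP => [[/subsetP eL je]|eL].
    apply/subsetP => i ie; have := eL i ie; rewrite inE => /orP[/eqP ij|//].
    by rewrite -ij ie in je.
  split; last by apply: contra jL => /(subsetP eL).
  by apply: subset_trans eL _; apply/subsetP => i iL; rewrite inE iL orbT.
rewrite -size_filter -(card_uniqP (filter_uniq _ uL)).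
rewrite -(card_in_imset (f := fun i => [set j; i]) (D := mem [seq i <- L | adj F j i])).
  apply: eq_card => e; rewrite !inE; apply/idP/imsetP => [/andP[/andP[eF /subsetP eL] je]|[i]].
    have [u [v [eE uv]]] := edge_adj eF; subst e.
    have [i eE ji] : exists2 i, [set u; v] = [set j; i] & adj F j i.
      move: je; rewrite !inE => /orP[]/eqP ->; first by exists v.
      by exists u; rewrite 1?setUC // adj_sym.
    exists i => //; rewrite mem_filter ji.
    have := eL i; rewrite eE !inE eqxx orbT => /(_ isT) /orP[/eqP ij|//].
    by have := adj_neq ji; rewrite ij eqxx.
  rewrite mem_filter => /andP[ji iL] ->.
  have -> : [set j; i] \in edges F by [].
  rewrite !inE eqxx andbT /=.
  by apply/subsetP => k; rewrite !inE => /orP[]/eqP ->; rewrite ?eqxx // iL orbT.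
move=> i i' /=; rewrite !mem_filter => /andP[ji _] _ e.
have : i \in [set j; i'] by rewrite -e !inE eqxx orbT.
by rewrite !inE eq_sym (negPf (adj_neq ji)) => /eqP.
Qed.

Section Target.
Variables (T : finType) (G : sgraph T).
Implicit Types (D : V -> {set T}) (g : {ffun V -> T}).

(** The embeddings of the subgraph induced on L with the image of i in D i. They
    are completed by the values of g outside L in order to remain functions on
    V, which lets L shrink while the type stays the same. *)
Definition embeddings L D g : {set {ffun V -> T}} :=
  [set f : {ffun V -> T} |
    [forall i, if i \in L then f i \in D i else f i == g i] &&
    [forall i in L, forall j in L,
       (adj F i j ==> adj G (f i) (f j)) && ((i != j) ==> (f i != f j))]].

Definition nbrs x : {set T} := [set y | adj G x y].

(** The candidates for i once x has been chosen as the image of j. Removing x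
    keeps the candidate sets away from the vertices in use, as
    [capacity_shrink] requires. *)
Definition shrink j x D i : {set T} :=
  (if adj F j i then D i :&: nbrs x else D i) :\ x.

Definition update g j x : {ffun V -> T} := [ffun i => if i == j then x else g i].

Lemma card_embeddings_cons j L D g : j \notin L ->
  #|embeddings (j :: L) D g| <=
    \sum_(x in D j) #|embeddings L (shrink j x D) (update g j x)|.
Proof.
move=> jL; set E := embeddings _ _ _.
have -> : #|E| = \sum_(x in D j) #|[set f in E | f j == x]|.
  rewrite -sum1_card (partition_big (fun f : {ffun V -> T} => f j) (mem (D j))) /=.
    by apply: eq_bigr => x _; rewrite -sum1_card; apply: eq_bigl => f; rewrite inE.
  by move=> f; rewrite inE => /andP[/forallP /(_ j)]; rewrite mem_head.
apply: leq_sum => x _; apply: subset_leq_card; apply/subsetP => f.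
rewrite !inE => /andP[/andP[/forallP fD /forall_inP fE] /eqP fj].
apply/andP; split; last first.
  apply/forall_inP => i iL; apply/forall_inP => k kL.
  by have /forall_inP := fE i (mem_behead (s := j :: L) iL); apply; apply: mem_behead.
apply/forallP => i; have := fD i; rewrite inE ffunE.
have [->|ij] := eqVneq i j; first by rewrite (negPf jL) fj.
rewrite /=; case: ifP => // iL fiD.
have /forall_inP := fE j (mem_head j L) => /(_ i (mem_behead (s := j :: L) iL)).
rewrite eq_sym ij /= fj => /andP[/implyP ji xi]; rewrite !inE eq_sym xi /=.
by case: ifP => // /ji xfi; rewrite !inE fiD.
Qed.

Lemma card_embeddings_le L D g : uniq L ->
  #|embeddings L D g| <= \prod_(i <- L) #|D i|.
Proof.
elim: L D g => [|j L IH] D g /=.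
  move=> _; rewrite big_nil -(cards1 g); apply: subset_leq_card; apply/subsetP => f.
  rewrite !inE => /andP[/forallP h _]; apply/eqP/ffunP => i.
  exact/eqP/(h i).
move=> /andP[jL uL]; apply: leq_trans (card_embeddings_cons _ _ jL) _.
rewrite big_cons -sum_nat_const; apply: leq_sum => x _.
apply: leq_trans (IH _ _ uL) _; rewrite !big_seq; apply: leq_prod => i _.
apply: subset_leq_card; rewrite /shrink; case: ifP => _.
  by apply: subset_trans (subD1set _ _) _; apply: subsetIl.
exact: subD1set.
Qed.

(** The neighbours of x that are adjacent to all of Y are the vertices adjacent to
    all of x |: Y, a set with one more element. *)
Lemma capacity_shrink t k (A : {set T}) D i j x :
    x \in A -> adj F j i -> 0 < k -> capacity G t k A (D i) ->
  capacity G t k.-1 (A :\ x) (shrink j x D i).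
Proof.
move=> xA ji k0 cap Y YA cY.
have xY : x \notin Y by apply/negP => /(subsetP YA); rewrite !inE eqxx.
have := cap (x |: Y); rewrite cardsU1 xY cY add1n prednK //.
rewrite subUset sub1set xA (subset_trans YA (subD1set _ _)) => /(_ isT erefl).
apply: leq_trans; apply: subset_leq_card; apply/subsetP => z.
rewrite !inE /shrink ji !inE => /andP[/andP[_ /andP[-> xz]] /forall_inP Yz] /=.
by apply/forall_inP => y; rewrite !inE => /orP[/eqP->|/Yz].
Qed.

Lemma capacity_sub t k (A A' B B' : {set T}) :
  A' \subset A -> B' \subset B -> capacity G t k A B -> capacity G t k A' B'.
Proof.
move=> AA BB cap Y YA cY; apply: leq_trans (cap Y (subset_trans YA AA) cY).
by apply: subset_leq_card; apply: setSI.
Qed.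

Lemma shrink_sub j x D i : shrink j x D i \subset D i.
Proof.
rewrite /shrink; case: ifP => _; last exact: subD1set.
by apply: subset_trans (subD1set _ _) _; apply: subsetIl.
Qed.

End Target.
End Embeddings.

Section EmbeddingBound.
Local Open Scope ring_scope.

Section Bound.
Variables (R : realType) (V : finType) (F : sgraph V) (t : nat).

(** The images x of j to which [sum_exp_degrees] applies, for all the candidate
    sets that the choice of x restricts. *)
Definition rich (T : finType) (G : sgraph T) (D : V -> {set T}) (L : seq V)
    (j : V) (k : nat) (x : T) : bool :=
  all (fun i => adj F j i ==> (2 * k <= #|shrink F G j x D i|)%N) L.

(** The choice of the image of j replaces the sizes of the candidate sets of its
    neighbours by the degrees of x. Summed over x, the product of these degrees
    is at most what it would be if each degree were the fraction
    |D j|^(-1 / k j) of the candidate set, up to a constant. *)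
Lemma rich_sum_le (T : finType) (G : sgraph T) (A : {set T}) (D : V -> {set T})
    (L : seq V) (j : V) (k : V -> nat) (lam : V -> R) :
    (0 < k j)%N -> (forall i, 0 <= lam i) -> {in L, forall i, D i \subset A} ->
    capacity G t (k j) A (D j) ->
    \sum_(i <- L | adj F j i) lam i <= (k j)%:R ->
  \sum_(x in D j | rich G D L j (k j) x)
     \prod_(i <- L) #|shrink F G j x D i|%:R `^ lam i
  <= (1 + (size L * 2 ^ k j * t)%:R) *
     (#|D j|%:R `^ (1 - (\sum_(i <- L | adj F j i) lam i) / (k j)%:R)
      * \prod_(i <- L) #|D i|%:R `^ lam i).
Proof.
move=> k0 l0 DA cap lk; pose P x := rich G D L j (k j) x.
set La := \sum_(i <- L | _) _ in lk *.
have [Dj0|d0] := posnP #|D j|.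
  rewrite big1 => [|x /andP[xD _]]; last by have := card0_eq Dj0 x; rewrite xD.
    apply: mulr_ge0; first by rewrite addr_ge0.
    by apply: mulr_ge0; [apply: powR_ge0 | apply: prodr_ge0 => i _; apply: powR_ge0].
have dR : 0 < #|D j|%:R :> R by rewrite ltr0n.
set d : R := #|D j|%:R in dR *.
pose m i : R := #|D i|%:R; pose r := [seq i <- L | adj F j i].
pose a x i : R := #|shrink F G j x D i|%:R.
have am x i : a x i <= m i by rewrite ler_nat subset_leq_card // shrink_sub.
have a0 x i : 0 <= a x i by [].
pose Q x := \sum_(i <- L | adj F j i) (a x i ^+ k j / m i ^+ k j).
have step x : P x -> \prod_(i <- L) a x i `^ lam i <=
    \prod_(i <- L) m i `^ lam i * d `^ (- (La / (k j)%:R)) * (1 + d * Q x).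
  move=> /allP Px.
  have m0 : {in r, forall i, 0 < m i}.
    move=> i; rewrite mem_filter => /andP[ji iL]; rewrite (lt_le_trans _ (am x i)) //.
    by have := Px i iL; rewrite ji /= ltr0n; lia.
  have := @prod_powR_balance R _ r (a x) m lam d (k j) (fun i _ => a0 x i) m0
    (fun i _ => l0 i) dR k0.
  rewrite !big_filter -/La -mulr_sumr -/(Q x) => /(_ lk) H.
  rewrite (bigID (adj F j)) /= [\prod_(i <- L) m i `^ _](bigID (adj F j)) /=.
  have le2 : \prod_(i <- L | ~~ adj F j i) a x i `^ lam i <=
             \prod_(i <- L | ~~ adj F j i) m i `^ lam i.
    apply: ler_prod => i _; rewrite powR_ge0 /=.
    by apply: ge0_ler_powR; rewrite ?nnegrE ?am.
  have pr0 p : 0 <= \prod_(i <- L | p i) a x i `^ lam i.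
    by apply: prodr_ge0 => i _; apply: powR_ge0.
  apply: le_trans (ler_pM (pr0 _) (pr0 _) H le2) _.
  by rewrite le_eqVlt; apply/orP; left; apply/eqP; ring.
apply: (@le_trans _ _ (\sum_(x in D j | P x)
  \prod_(i <- L) m i `^ lam i * d `^ (- (La / (k j)%:R)) * (1 + d * Q x))).
  by apply: ler_sum => x /andP[_]; apply: step.
rewrite -mulr_sumr big_split /= -mulr_sumr.
have Q_le : \sum_(x in D j | P x) Q x <= (size L * 2 ^ k j * t)%:R.
  rewrite /Q exchange_big /= -big_filter -/r.
  apply: (@le_trans _ _ (\sum_(i <- r) (2 ^ k j * t)%:R)).
    rewrite !big_seq; apply: ler_sum => i; rewrite mem_filter => /andP[ji iL].
    have [m0|m0] := posnP #|D i|.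
      by rewrite big1 // => x _; rewrite /m m0 expr0n eqn0Ngt k0 invr0 mulr0.
    have mk0 : 0 < m i ^+ k j by rewrite exprn_gt0 // ltr0n.
    rewrite -mulr_suml ler_pdivrMr // /a /m.
    under eq_bigr do rewrite -natrX.
    rewrite -natr_sum -natrX -natrM ler_nat.
    apply: leq_trans (sum_exp_degrees (N := fun x => shrink F G j x D i) cap
      (DA i iL) _ _).
    - rewrite big_mkcondr [X in (_ <= X)%N]big_mkcondr /=; apply: leq_sum => x _.
      case: ifP => // /allP /(_ i iL) /implyP /(_ ji) -> //.
    - by move=> x; apply: shrink_sub.
    - by move=> x y; rewrite /shrink ji !inE => /andP[_ /andP[]].
  rewrite big_const_seq count_predT iter_addr_0 -mulrnA ler_nat.
  by rewrite mulnC -mulnA leq_mul2r size_filter count_size orbT.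
have one_le : \sum_(x in D j | P x) 1 <= d.
  rewrite big_mkcondr /=; apply: (@le_trans _ _ (\sum_(x in D j) 1)).
    by apply: ler_sum => x _; case: ifP.
  by rewrite sumr_const.
apply: (@le_trans _ _ (\prod_(i <- L) m i `^ lam i * d `^ (- (La / (k j)%:R)) *
   (d + d * (size L * 2 ^ k j * t)%:R))).
  apply: ler_wpM2l.
    by rewrite mulr_ge0 ?powR_ge0 // prodr_ge0 // => i _; apply: powR_ge0.
  by apply: lerD => //; apply: ler_wpM2l Q_le; apply: ltW.
rewrite powRD; last by rewrite (gt_eqF dR) implybT.
rewrite powRr1 ?(ltW dR) // le_eqVlt; apply/orP; left; apply/eqP.
ring.
Qed.

(** A poor image leaves less than 2k candidates for some vertex, which replaces a
    factor n in the trivial bound. *)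
Lemma poor_card_le (T : finType) (G : sgraph T) (D : V -> {set T})
    (L : seq V) (j : V) (k : nat) (g : {ffun V -> T}) (x : T) : uniq L ->
    ~~ rich G D L j k x ->
  (#|embeddings F G L (shrink F G j x D) g|%:R : R) <=
    (2 * k)%:R * (#|T|%:R ^+ size L / #|T|%:R).
Proof.
move=> uL /allPn[i iL]; rewrite negb_imply -ltnNge => /andP[_ ik].
have T0 : (0 < #|T|)%N by apply/card_gt0P; exists x.
have TR : #|T|%:R != 0 :> R by rewrite pnatr_eq0 -lt0n.
have sL : (0 < size L)%N by rewrite -has_predT; apply/hasP; exists i.
rewrite -[X in _ ^+ X](prednK sL) exprSr mulfK // -natrX -natrM ler_nat.
apply: leq_trans (card_embeddings_le _ _ _ _ uL) _.
rewrite (big_rem i) //=; apply: leq_mul; first exact: ltnW.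
rewrite -(size_rem iL); elim: (rem i L) => [|i' s IH]; first by rewrite big_nil.
by rewrite big_cons expnS leq_mul // max_card.
Qed.

(** The capacities k i may differ because they drop by one for the neighbours of
    each embedded vertex. The exponent of the first vertex j is
    1 - (sum of the exponents of its neighbours) / k j, by [rich_sum_le]. The
    exponents are recorded only through the sum of lam i * k i, which the
    induction reproduces: passing from the capacities of the tail to those of
    the whole list adds the exponents of the neighbours of j, which the term
    lam j * k j = k j - (sum of the exponents of the neighbours) takes away,
    while on the right-hand side the drop of the capacities becomes the number
    of edges at j. When all k i equal s, the exponents sum to v - e/s. *)
Theorem embeddings_bound (L : seq V) : uniq L ->
  forall k : V -> nat, {in L, forall i, (size L <= k i)%N} ->
  exists (lam : V -> R) (C : R), [/\ 0 <= C, forall i, 0 <= lam i <= 1,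
    \sum_(i <- L) lam i * (k i)%:R = (\sum_(i <- L) k i)%:R - #|edges_in F L|%:R
  & forall (T : finType) (G : sgraph T) (A : {set T}) (D : V -> {set T})
      (g : {ffun V -> T}),
    {in L, forall i, D i \subset A} ->
    {in L, forall i, capacity G t (k i) A (D i)} ->
    #|embeddings F G L D g|%:R <= C * (\prod_(i <- L) #|D i|%:R `^ lam i
                                      + #|T|%:R ^+ size L / #|T|%:R)].
Proof.
elim: L => [_ k _|j L IH /[dup] ujL /= /andP[jL uL] k kL].
  exists (fun=> 0), 1; split=> //.
  - by move=> i; rewrite lexx ler01.
  - rewrite !big_nil (_ : edges_in F [::] = set0) ?cards0 ?subrr //.
    apply/setP => e; rewrite !inE; apply/negP => /andP[/edge_adj[u [v [-> _]]]].
    by move/subsetP => /(_ u); rewrite !inE eqxx => /(_ isT).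
  - move=> T G A D g _ _; rewrite !big_nil mul1r expr0.
    apply: (@le_trans _ _ 1); last by rewrite lerDl divr_ge0.
    have := card_embeddings_le F G D g (isT : uniq [::]); rewrite big_nil.
    by rewrite (ler_nat R _ 1).
(* The capacities left once j is embedded. *)
pose k' i := (k i - adj F j i)%N.
have k'L : {in L, forall i, (size L <= k' i)%N}.
  move=> i iL; have := kL i (mem_behead (s := j :: L) iL).
  by rewrite /k' /=; case: (adj F j i); lia.
have [lam' [C' [C'0 lam'01 lam'sum IHL]]] := IH uL k' k'L.
have kj := kL j (mem_head j L).
have kj0 : (0 < k j)%N by apply: leq_trans kj.
have kjR : 0 < (k j)%:R :> R by rewrite ltr0n.
pose La := \sum_(i <- L | adj F j i) lam' i.
have La0 : 0 <= La by apply: sumr_ge0 => i _; case/andP: (lam'01 i).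
have Lak : La <= (k j)%:R.
  apply: (@le_trans _ _ (\sum_(i <- L) 1)).
    rewrite /La big_mkcond; apply: ler_sum => i _.
    by case: ifP => _ //; case/andP: (lam'01 i).
  by rewrite big_const_seq count_predT iter_addr_0 ler_nat (leq_trans _ kj).
pose lam i := if i == j then 1 - La / (k j)%:R else lam' i.
have lamL (p : pred V) (f : V -> R -> R) :
    \sum_(i <- L | p i) f i (lam i) = \sum_(i <- L | p i) f i (lam' i).
  rewrite [LHS]big_seq_cond [RHS]big_seq_cond.
  apply: eq_bigr => i /andP[iL _]; rewrite /lam.
  by case: eqP => // e; rewrite e (negPf jL) in iL.
exists lam, (C' * (1 + (size L * 2 ^ k j * t)%:R) + C' + (2 * k j)%:R); split.
- by rewrite !addr_ge0 // mulr_ge0 // addr_ge0.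
- move=> i; rewrite /lam; case: eqP => // _.
  by rewrite subr_ge0 ler_pdivrMr // mul1r Lak lerBlDr lerDl divr_ge0 // ltW.
- rewrite !big_cons (lamL predT (fun i x => x * (k i)%:R)).
  rewrite card_edges_in_cons // /lam eqxx.
  have -> : \sum_(i <- L) lam' i * (k i)%:R =
      \sum_(i <- L) lam' i * (k' i)%:R + La.
    rewrite /La [X in _ + X]big_mkcond -big_split /= !big_seq; apply: eq_bigr => i iL.
    have := kL i (mem_behead (s := j :: L) iL) => /= ki.
    rewrite /k'; case: (adj F j i); last by rewrite subn0 addr0.
    by rewrite natrB ?(leq_trans _ ki) // mulrBr mulr1 subrK.
  have -> : (\sum_(i <- L) k i = \sum_(i <- L) k' i + count (adj F j) L)%N.
    rewrite -sum1_count [X in (_ + X)%N]big_mkcond -big_split /= !big_seq.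
    apply: eq_bigr => i iL; have := kL i (mem_behead (s := j :: L) iL) => /= ki.
    by rewrite /k'; case: (adj F j i); lia.
  rewrite lam'sum mulrBl mul1r divfK ?gt_eqF // !natrD; ring.
move=> T G A D g DA cap.
(* The sum over the images x of j is split into rich and poor ones; the poor
   ones go into the error term. *)
have nE : 0 <= #|T|%:R ^+ size L / #|T|%:R :> R by rewrite divr_ge0 // exprn_ge0.
set E := _ / _ in nE.
apply: (@le_trans _ _ (\sum_(x in D j)
    #|embeddings F G L (shrink F G j x D) (update g j x)|%:R)).
  by rewrite -natr_sum ler_nat; apply: card_embeddings_cons.
rewrite (bigID (rich G D L j (k j))) /=.
have DjA : D j \subset A by apply: DA; apply: mem_head.
have rich_le : \sum_(x in D j | rich G D L j (k j) x)
    #|embeddings F G L (shrink F G j x D) (update g j x)|%:R <=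
    C' * ((1 + (size L * 2 ^ k j * t)%:R) *
      \prod_(i <- j :: L) #|D i|%:R `^ lam i + #|T|%:R * E).
  apply: (@le_trans _ _ (\sum_(x in D j | rich G D L j (k j) x)
    C' * (\prod_(i <- L) #|shrink F G j x D i|%:R `^ lam' i + E))).
    apply: ler_sum => x /andP[xD _]; apply: (IHL _ _ (A :\ x)) => i iL.
      rewrite subsetD (subset_trans (shrink_sub _ _ _ _ _ _)) ?DA ?inE ?iL ?orbT //.
      by rewrite disjoint_sym disjoints1 !inE eqxx.
    have iL' : i \in j :: L by rewrite inE iL orbT.
    rewrite /k'; case ji: (adj F j i); last first.
      by rewrite subn0; apply: capacity_sub (cap i iL'); [apply: subD1set | apply: shrink_sub].
    rewrite subn1; apply: capacity_shrink (cap i iL') => //.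
      exact: (subsetP DjA).
    by apply: leq_trans (kL i iL').
  rewrite -mulr_sumr; apply: ler_wpM2l => //; rewrite big_split /=.
  apply: lerD.
    apply: le_trans (rich_sum_le kj0 _ (A := A) _ (cap j (mem_head j L)) Lak) _.
    - by move=> i; case/andP: (lam'01 i).
    - by move=> i iL; apply: DA; rewrite inE iL orbT.
    apply: ler_wpM2l; first by rewrite addr_ge0.
    rewrite big_cons /lam eqxx -/La le_eqVlt; apply/orP; left; apply/eqP; congr (_ * _).
    rewrite !big_seq; apply: eq_bigr => i iL.
    by case: eqP => // e; rewrite e (negPf jL) in iL.
  rewrite big_mkcondr /=; apply: (@le_trans _ _ (\sum_(x in T) E)).
    rewrite big_mkcond /=; apply: ler_sum => x _.
    by case: ifP => // _; case: ifP.
  by rewrite sumr_const mulr_natl.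
have poor_le : \sum_(x in D j | ~~ rich G D L j (k j) x)
    #|embeddings F G L (shrink F G j x D) (update g j x)|%:R <=
    (2 * k j)%:R * (#|T|%:R * E).
  apply: (@le_trans _ _ (\sum_(x in T) (2 * k j)%:R * E)).
    rewrite big_mkcond [leRHS]big_mkcond /=; apply: ler_sum => x _.
    have c0 : 0 <= (2 * k j)%:R * E by rewrite mulr_ge0.
    by case: ifP => // /andP[_ /poor_card_le]; apply.
  by rewrite sumr_const -mulrnAr [#|T|%:R * E]mulr_natl.
have -> : #|T|%:R ^+ (size (j :: L)) / #|T|%:R = #|T|%:R * E by rewrite exprS -mulrA.
have nE' : 0 <= #|T|%:R * E by rewrite mulr_ge0.
set Pr := \prod_(i <- j :: L) _ in rich_le *.
have Pr0 : 0 <= Pr by apply: prodr_ge0 => i _; apply: powR_ge0.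
apply: le_trans (lerD rich_le poor_le) _.
set w := (size L * 2 ^ k j * t)%:R; set u := (2 * k j)%:R; set v := #|T|%:R * E.
have w0 : 0 <= w by []. have u0 : 0 <= u by [].
rewrite -subr_ge0; have -> : (C' * (1 + w) + C' + u) * (Pr + v) - (C' * ((1 + w) * Pr + v) + u * v)
   = C' * Pr + u * Pr + C' * (1 + w) * v by ring.
by rewrite !(addr_ge0, mulr_ge0) // ?exprn_ge0 ?invr_ge0.
Qed.

End Bound.

End EmbeddingBound.

(** * The growth of ex(n, F, K_(s,t)) *)

Section Exponents.
Local Open Scope ring_scope.

Lemma copies_le_embeddings (V T : finType) (F : sgraph V) (G : sgraph T) g :
  (#|copies F G| <= #|embeddings F G (enum V) (fun=> [set: T]) g|)%N.
Proof.
set E := embeddings _ _ _ _ _.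
pose copy (f : {ffun V -> T}) := (f @: [set: V], [set f @: e | e : {set V} in edges F]).
apply: leq_trans (leq_imset_card copy E); apply: subset_leq_card.
apply/subsetP => S /embedding_of_copies[f [injf fadj ->]].
apply: imset_f; rewrite inE; apply/andP; split.
  by apply/forallP => i; rewrite mem_enum inE.
apply/forall_inP => i _; apply/forall_inP => j _; rewrite (inj_eq injf) implybb andbT.
by apply/implyP/fadj.
Qed.

Definition exponent (R : realType) (V : finType) (F : sgraph V) (s : nat) : R :=
  #|V|%:R - #|edges F|%:R / s%:R.

Lemma exnum_biclique_le (R : realType) (V : finType) (F : sgraph V) (s t : nat) :
    (0 < s)%N -> (#|V| <= s)%N -> (#|edges F| <= s)%N ->
  exists2 C : R, 0 < C & forall n, (0 < n)%N ->
    (exnum n F (biclique s t.+1))%:R <= C * n%:R `^ exponent R F s.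
Proof.
move=> s0 Vs Es.
have sR : 0 < s%:R :> R by rewrite ltr0n.
have [|lam [C [C0 lam01 lamsum bound]]] :=
  @embeddings_bound R V F t (enum V) (enum_uniq _) (fun=> s).
  by move=> i _; rewrite -cardE.
exists (2 * (C + 1)) => [|n n0]; first by rewrite mulr_gt0 // ltr_wpDl.
have nR : 0 < n%:R :> R by rewrite ltr0n.
have n1 : 1 <= n%:R :> R by rewrite ler1n.
have sumlam : \sum_(i <- enum V) lam i = exponent R F s.
  apply: (mulIf (lt0r_neq0 sR)); rewrite mulr_suml lamsum big_const_seq count_predT.
  rewrite iter_addn_0 -cardE (_ : edges_in F _ = edges F).
    by rewrite mulrBl divfK ?lt0r_neq0 // natrM mulrC.
  apply/setP => e; rewrite inE; case: (e \in edges F) => //=.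
  by apply/subsetP => i _; rewrite mem_enum.
rewrite /exnum; elim/big_ind: _ => [|x y hx hy|G /free_of_biclique freeG].
- by rewrite mulr_ge0 ?powR_ge0 // mulr_ge0 // addr_ge0.
- by rewrite /maxn; case: ifP.
pose g : {ffun V -> 'I_n} := [ffun=> Ordinal n0].
apply: (@le_trans _ _ #|embeddings F G (enum V) (fun=> [set: 'I_n]) g|%:R).
  by rewrite ler_nat copies_le_embeddings.
apply: le_trans (bound _ G setT _ g _ _) _ => [i _|i _ Y _ cY|].
- exact: subxx.
- by rewrite setTI -ltnS freeG.
rewrite -cardE cardsT card_ord.
have -> : \prod_(i <- enum V) n%:R `^ lam i = n%:R `^ exponent R F s.
  rewrite -sumlam; elim/big_rec2: _ => [|i y z _ ->]; first by rewrite powRr0.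
  by rewrite powRD // (gt_eqF nR) implybT.
have le_pow : n%:R ^+ #|V| / n%:R <= n%:R `^ exponent R F s.
  rewrite -powR_mulrn ?(ltW nR) // -powR_inv1 ?(ltW nR) // -powRD; last first.
    by rewrite (gt_eqF nR) implybT.
  by rewrite ler_powR // lerD2l lerN2 ler_pdivrMr // mul1r ler_nat.
apply: (@le_trans _ _ (C * (n%:R `^ exponent R F s + n%:R `^ exponent R F s))).
  by rewrite ler_wpM2l // lerD2l.
have p0 : 0 <= n%:R `^ exponent R F s := powR_ge0 _ _.
by move: p0; set p := _ `^ _ => p0; nra.
Qed.

(** With k the largest integer such that #|V| * 2^(k s) <= n, the number 2^(k s)
    is within a factor #|V| * 2^s of n, so that the gaps between the powers of
    2^s affect the constant only. *)
Lemma exnum_biclique_ge_powR (R : realType) (V : finType) (F : sgraph V) (s : nat) :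
    (0 < s)%N -> (#|edges F| <= s)%N -> (0 < #|V|)%N ->
  exists2 c : R, 0 < c & exists N, forall n, (N <= n)%N ->
    c * n%:R `^ exponent R F s <=
      (exnum n F (biclique s (#|V| * norm_system_bound s).+1))%:R.
Proof.
move=> s0 Es V0; set t := (_ * _)%N; set r := exponent R F s.
have sR : 0 < s%:R :> R by rewrite ltr0n.
have V1 : 1 <= #|V|%:R :> R by rewrite ler1n.
have EsV : (#|edges F| <= s * #|V|)%N by rewrite (leq_trans Es) // leq_pmulr.
have r0 : 0 <= r.
  rewrite /r /exponent subr_ge0 (le_trans _ V1) // ler_pdivrMr // mul1r.
  by rewrite ler_nat.
pose M := (#|V| * 2 ^ s)%N.
have MR : 0 < M%:R :> R by rewrite ltr0n muln_gt0 V0 expn_gt0.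
exists (M%:R^-1 `^ r); first by rewrite powR_gt0 // invr_gt0.
(* For n beyond the bound below, k is large enough for 2^k > #|{set V}|. *)
pose k0 := #|{set V}|.+1.
exists (#|V| * (2 ^ s) ^ k0)%N => n nN.
have s1 : (1 < 2 ^ s)%N by rewrite -[1%N](expn0 2) ltn_exp2l.
pose m := (n %/ #|V|)%N.
have km : ((2 ^ s) ^ k0 <= m)%N by rewrite leq_divRL // mulnC.
have m0 : (0 < m)%N by apply: leq_trans km; rewrite expn_gt0 (ltnW s1).
pose k := trunc_log (2 ^ s) m.
have k0k : (k0 <= k)%N by apply: trunc_log_max.
have /andP[mk mk'] := trunc_log_bounds s1 m0; rewrite -/k in mk mk'.
have Vm : (#|V| * m <= n)%N by rewrite mulnC leq_trunc_div.
have comm : ((2 ^ k) ^ s = (2 ^ s) ^ k)%N by rewrite -!expnM mulnC.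
have lower : ((2 ^ k) ^ (s * #|V| - #|edges F|) <= exnum n F (biclique s t.+1))%N.
  apply: exnum_biclique_ge => //; first by apply: leq_trans k0k.
    by apply: leq_trans (ltn_expl k (isT : 1 < 2)%N); rewrite ltnS; apply: ltnW.
  by rewrite comm (leq_trans _ Vm) // leq_mul2l mk orbT.
apply: (@le_trans _ _ ((2 ^ k) ^ (s * #|V| - #|edges F|))%:R); last by rewrite ler_nat.
have -> : ((2 ^ k) ^ (s * #|V| - #|edges F|))%:R = ((2 ^ k) ^ s)%:R `^ r :> R.
  have X j : ((2 ^ k) ^ j)%:R = (2 ^ k)%:R `^ j%:R :> R by rewrite natrX powR_mulrn.
  rewrite !X -[RHS]powRrM; congr (_ `^ _).
  by rewrite /r /exponent natrB // natrM mulrBr [_ * (_ / _)]mulrC divfK // gt_eqF.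
rewrite -powRM ?invr_ge0 //; apply: ge0_ler_powR; rewrite ?nnegrE ?mulr_ge0 ?invr_ge0 //.
rewrite ler_pdivrMl // -natrM ler_nat comm.
have : (n < #|V| * m.+1)%N by rewrite mulnC ltn_ceil.
rewrite /M -mulnA -expnS => /ltnW/leq_trans; apply.
by rewrite leq_mul2l mk' orbT.
Qed.

End Exponents.

From mathcomp Require Import all_classical all_reals all_analysis.
Import Order.TTheory GRing.Theory Num.Theory.
Import numFieldNormedType.Exports.
Local Open Scope classical_set_scope.
Local Open Scope ring_scope.

Lemma exnum_biclique_Theta (R : realType) (V : finType) (F : sgraph V) (s : nat) :
    (0 < #|V|)%N -> (#|V| <= s)%N -> (#|edges F| <= s)%N ->
  (fun n : nat => (exnum n F (biclique s (#|V| * norm_system_bound s).+1))%:R : R^o)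
    \is 'Theta_\oo (fun n : nat => n%:R `^ exponent R F s : R^o).
Proof.
move=> V0 Vs Es; have s0 := leq_trans V0 Vs.
have [C C0 upper] := @exnum_biclique_le R V F s (#|V| * norm_system_bound s) s0 Vs Es.
have [c c0 [N lower]] := @exnum_biclique_ge_powR R V F s s0 Es V0.
rewrite qualifE; apply/asboolP; exists (c, C) => /=; first by rewrite c0 C0.
near=> n; have n0 : (0 < n)%N by near: n; exact: nbhs_infty_gt.
rewrite !ger0_norm ?powR_ge0 //; split; last exact: upper.
by apply: lower; near: n; exact: nbhs_infty_ge.
Unshelve. all: by end_near. Qed.

Lemma exponent_inj (R : realType) (V : finType) (F : sgraph V) :
  edges F != finset.set0 -> injective (fun i => exponent R F i.+1).
Proof.
rewrite -card_gt0 => E0 i j /addrI/oppr_inj.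
have ER : #|edges F|%:R != 0 :> R by rewrite pnatr_eq0 -lt0n.
by move/(mulfI ER)/invr_inj/eqP; rewrite eqr_nat => /eqP[].
Qed.

Theorem theorem1p2 (R : realType) (V : finType) (F : sgraph V)
    (F_has_edge : edges F != finset.set0) :
  infinite_set [set r : R | exists (W : finType) (H : sgraph W),
    (fun n : nat => (exnum n F H)%:R : R^o) \is 'Theta_\oo
      (fun n : nat => n%:R `^ r : R^o)].
Proof.
set A := [set r | _].
have V0 : (0 < #|V|)%N.
  have [e eF] := finset.set0Pn _ F_has_edge.
  by rewrite (leq_trans _ (max_card (mem e))) // (edge_card2 eF).
pose r i := exponent R F (#|V| + #|edges F| + i).+1.
have rA i : A (r i).
  exists ('I_(#|V| + #|edges F| + i).+1 + 'I_(#|V| * norm_system_bound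
    (#|V| + #|edges F| + i).+1).+1)%type, (biclique _ _).
  by apply: exnum_biclique_Theta; rewrite // leqW // -addnA ?leq_addr // addnCA leq_addr.
have inj_r : injective r.
  by move=> i j /(@exponent_inj R V F F_has_edge) /addnI.
move=> finA; apply: infinite_nat.
have -> : [set: nat] = r @^-1` A by apply/seteqP; split=> i _ //; apply: rA.
by apply: finite_preimage finA => i j _ _; apply: inj_r.
Qed.
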